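(* Let $(J,\gamma)$ be an indecomposable real nilpotent metrised Jordan algebra of dimension 5, with $\gamma$ having signature $(+++--)$ and $\det\gamma=\pm1$. Then $(J,\gamma)$ is isomorphic by a unimodular isomorphism to exactly one of the metrised algebras on $\mathbb R^5$ with structure coefficients given by $$K^4_{55}=K^1_{25}=K^1_{52}=a,\quad K^3_{44}=K^2_{34}=K^2_{43}=b,\quad K^3_{45}=K^3_{54}=K^2_{35}=K^2_{53}=K^1_{34}=K^1_{43}=c,$$ $$K^3_{55}=K^1_{35}=K^1_{53}=d,\quad K^2_{44}=e,\quad K^1_{44}=K^2_{45}=K^2_{54}=f,\quad K^2_{55}=K^1_{45}=K^1_{54}=g,\quad K^1_{55}=h,$$ all other structure coefficients being zero, with $$\gamma=\begin{pmatrix}0&0&0&0&1\\0&0&0&1&0\\0&0&1&0&0\\0&1&0&0&0\\1&0&0&0&0\end{pmatrix},$$ and with $(a,b,c,d,e,f,g,h)$ equal to one of 1. $(0,\epsilon,0,0,0,0,1,0)$, 2. $(0,\epsilon,0,\epsilon,0,0,0,0)$, 3. $(0,\epsilon,0,\epsilon,\alpha,0,0,0)$, 4. $(0,0,1,0,0,0,0,0)$, 5. $(0,0,1,0,1,0,0,0)$, 6. $(0,0,1,0,\alpha,0,0,\epsilon\alpha)$, 7. $(1,0,1,0,1,0,0,0)$, where $\alpha>0$ is a real parameter and $\epsilon=\pm1$.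
   Context: A real Jordan algebra is a finite-dimensional real vector space with a commutative bilinear product $\bullet$ satisfying $x\bullet(x^2\bullet y)=x^2\bullet(x\bullet y)$ with $x^2=x\bullet x$. It is nilpotent if for some $m$ every product of $m$ elements vanishes. A trace form is a symmetric bilinear form $\gamma$ with $\gamma(u\bullet v,w)=\gamma(u,v\bullet w)$; $(J,\gamma)$ is metrised if $\gamma$ is a non-degenerate trace form on $J$. $(J,\gamma)$ is decomposable if $J$ is the direct sum of two non-zero, mutually $\gamma$-orthogonal ideals; otherwise it is indecomposable. Structure coefficients are defined by $e_\alpha\bullet e_\beta=\sum_\delta K^\delta_{\alpha\beta}e_\delta$ in the standard basis. The underlying vector space of $J$ is $\mathbb R^5$ (with its standard coordinates, in which $\det\gamma$ is computed); an isomorphism of metrised algebras is a linear isomorphism preserving the product and the trace form, and it is unimodular if its determinant is $1$. *)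

(* Defs.v *)
From HB Require Import structures.
From mathcomp Require Import all_boot all_order all_algebra.
From mathcomp Require Import reals.

Set Implicit Arguments.
Unset Strict Implicit.
Unset Printing Implicit Defensive.

Import Order.TTheory GRing.Theory Num.Theory.
Local Open Scope ring_scope.

Section MetrisedAlgebras.

Context {R : realType} {V : vectType R}.
Implicit Types (mul : V -> V -> V) (g : V -> V -> R).

Definition is_jordan mul : Prop :=
  [/\ (forall x, linear (mul x)),
      (forall y, linear (mul^~ y)),
      (forall x y, mul x y = mul y x) &
      (forall x y, mul x (mul (mul x x) y) = mul (mul x x) (mul x y))].

(* [is_product mul m x]: x is a product of m elements of V, bracketed in some
   way.  No x satisfies [is_product mul 0 x]. *)
Inductive is_product mul : nat -> V -> Prop :=
| product_one (x : V) : is_product mul 1 x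
| product_mul (m n : nat) (x y : V) :
    is_product mul m x -> is_product mul n y ->
    is_product mul (m + n) (mul x y).

Definition is_nilpotent mul : Prop :=
  exists2 m : nat, (0 < m)%N & forall x, is_product mul m x -> x = 0.

Definition is_trace_form mul g : Prop :=
  [/\ (forall x, scalar (g x)),
      (forall y, scalar (g^~ y)),
      (forall x y, g x y = g y x) &
      (forall u v w, g (mul u v) w = g u (mul v w))].

Definition nondegenerate g : Prop :=
  forall x, (forall y, g x y = 0) -> x = 0.

Definition is_metrised mul g : Prop :=
  is_trace_form mul g /\ nondegenerate g.

Definition is_ideal mul (U : {vspace V}) : Prop :=
  forall u v, u \in U -> mul u v \in U /\ mul v u \in U.

Definition decomposable mul g : Prop :=
  exists U W : {vspace V},
    [/\ is_ideal mul U /\ is_ideal mul W,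
        U != 0%VS /\ W != 0%VS,
        (U + W = fullv)%VS /\ (U :&: W = 0)%VS &
        forall u w, u \in U -> w \in W -> g u w = 0].

Definition indecomposable mul g : Prop := ~ decomposable mul g.

Definition has_signature g (p q : nat) : Prop :=
  exists b : (p + q).-tuple V,
    basis_of fullv b /\
    forall i j : 'I_(p + q),
      g b`_i b`_j = if i != j then 0 else if (i < p)%N then 1 else -1.

End MetrisedAlgebras.

Section Coordinates.

Context {R : realType} {n : nat}.
Implicit Types (mul : 'rV[R]_n -> 'rV[R]_n -> 'rV[R]_n)
               (g : 'rV[R]_n -> 'rV[R]_n -> R).

Definition gram g : 'M[R]_n :=
  \matrix_(i, j) g (delta_mx 0 i) (delta_mx 0 j).

Definition metrised_isomorphism mul g mul' g'
    (f : 'rV[R]_n -> 'rV[R]_n) : Prop :=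
  [/\ linear f,
      bijective f,
      (forall x y, f (mul x y) = mul' (f x) (f y)) &
      (forall x y, g' (f x) (f y) = g x y)].

Definition unimodular (f : 'rV[R]_n -> 'rV[R]_n) : Prop :=
  \det (lin1_mx f) = 1.

Definition unimodularly_isomorphic mul g mul' g' : Prop :=
  exists2 f, metrised_isomorphism mul g mul' g' f & unimodular f.

(* [K d a b] is the coefficient of e_d in the product of e_a and e_b. *)
Definition structure_mul (K : 'I_n -> 'I_n -> 'I_n -> R)
    (x y : 'rV[R]_n) : 'rV[R]_n :=
  \row_d \sum_a \sum_b x 0 a * y 0 b * K d a b.

Definition matrix_form (G : 'M[R]_n) (x y : 'rV[R]_n) : R :=
  (x *m G *m y^T) 0 0.

End Coordinates.

Record coefs (R : Type) : Type := Coefs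
  { ca : R; cb : R; cc : R; cd : R; ce : R; cf : R; cg : R; ch : R }.

Section NormalForms.

Context {R : realType}.

(* The indices d (upper), a, b (lower) are numbered from 1 to 5. *)
Definition normal_coef (p : coefs R) (d a b : nat) : R :=
  match d, a, b with
  | 4, 5, 5 | 1, 2, 5 | 1, 5, 2 => ca p
  | 3, 4, 4 | 2, 3, 4 | 2, 4, 3 => cb p
  | 3, 4, 5 | 3, 5, 4 | 2, 3, 5 | 2, 5, 3 | 1, 3, 4 | 1, 4, 3 => cc p
  | 3, 5, 5 | 1, 3, 5 | 1, 5, 3 => cd p
  | 2, 4, 4 => ce p
  | 1, 4, 4 | 2, 4, 5 | 2, 5, 4 => cf p
  | 2, 5, 5 | 1, 4, 5 | 1, 5, 4 => cg p
  | 1, 5, 5 => ch p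
  | _, _, _ => 0
  end.

Definition normal_mul (p : coefs R) : 'rV[R]_5 -> 'rV[R]_5 -> 'rV[R]_5 :=
  structure_mul (fun d a b : 'I_5 => normal_coef p d.+1 a.+1 b.+1).

Definition normal_form : 'rV[R]_5 -> 'rV[R]_5 -> R :=
  matrix_form (\matrix_(i < 5, j < 5) (i + j == 4)%N%:R).

Definition is_sign (eps : R) : Prop := eps = 1 \/ eps = -1.

Inductive normal_coefs : coefs R -> Prop :=
| normal1 eps : is_sign eps -> normal_coefs (Coefs 0 eps 0 0 0 0 1 0)
| normal2 eps : is_sign eps -> normal_coefs (Coefs 0 eps 0 eps 0 0 0 0)
| normal3 eps alpha : is_sign eps -> 0 < alpha ->
    normal_coefs (Coefs 0 eps 0 eps alpha 0 0 0)
| normal4 : normal_coefs (Coefs 0 0 1 0 0 0 0 0)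
| normal5 : normal_coefs (Coefs 0 0 1 0 1 0 0 0)
| normal6 eps alpha : is_sign eps -> 0 < alpha ->
    normal_coefs (Coefs 0 0 1 0 alpha 0 0 (eps * alpha))
| normal7 : normal_coefs (Coefs 1 0 1 0 1 0 0 0).

End NormalForms.

(* Main.v *)
From HB Require Import structures.
Require Import Defs.
From mathcomp Require Import all_boot all_order all_algebra.
From mathcomp Require Import boolp reals ring lra.

(* A commutative metrised algebra is a symmetric trilinear form together with the
   metric, so by polarisation it is determined by the cubic form
   F(x) = g (x * x) x and the quadratic form g x x, and changing the basis is
   substituting in these two polynomials.

   Existence. By nilpotency the annihilator is non-zero, and by
   indecomposability it is isotropic; modulo a null line <e1> in it there is a
   second null vector e2 with J e2 inside <e1>. Completing e1, e2 to a basis with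
   anti-diagonal Gram matrix brings F to the shape
     3 a x2 x5^2 + 3 x3 q(x4, x5) + C(x4, x5),
   q a binary quadratic and C a binary cubic form. The Jordan identity forces
   a = 0, or b = 0 and a e = c^2. If a = 0, the isometries act on (q, C) through
   linear substitutions of x4, x5 and by adding multiples of q to C. Hence q is
   normalised to rank at most 1, definite, or hyperbolic, and C modulo q is
   scaled, or rotated by a third of an angle. If a is non-zero, only the
   exceptional algebra and decomposable ones occur.

   Uniqueness. An isometry between two normal forms with a = 0 preserves their
   common annihilator <e1, e2>, hence is block triangular, and unimodularity
   makes its middle entry 1 rather than -1. Comparing coefficients leaves the
   discriminant and the sign of q, and invariants of C modulo q. *)

Set Implicit Arguments.
Unset Strict Implicit.
Unset Printing Implicit Defensive.

Import Order.TTheory GRing.Theory Num.Theory.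
Local Open Scope ring_scope.

(** * Coordinates on R^5 and the normal algebras *)

Definition i1 : 'I_5 := @Ordinal 5 0 isT.
Definition i2 : 'I_5 := @Ordinal 5 1 isT.
Definition i3 : 'I_5 := @Ordinal 5 2 isT.
Definition i4 : 'I_5 := @Ordinal 5 3 isT.
Definition i5 : 'I_5 := @Ordinal 5 4 isT.

Lemma big_I5 (S : nmodType) (F : 'I_5 -> S) :
  \sum_i F i = F i1 + F i2 + F i3 + F i4 + F i5.
Proof.
rewrite !big_ord_recl big_ord0 addr0 !addrA.
by congr (F _ + F _ + F _ + F _ + F _); apply: val_inj.
Qed.

Lemma I5P (P : 'I_5 -> Prop) : P i1 -> P i2 -> P i3 -> P i4 -> P i5 -> forall i, P i.
Proof.
move=> P1 P2 P3 P4 P5 [[|[|[|[|[|//]]]]] lt_i5];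
  by [rewrite (bool_irrelevance lt_i5 isT)].
Qed.

Definition row5 {R : realType} (x1 x2 x3 x4 x5 : R) : 'rV[R]_5 :=
  \row_j nth 0 [:: x1; x2; x3; x4; x5] j.

Lemma row5K {R : realType} (x : 'rV[R]_5) :
  x = row5 (x 0 i1) (x 0 i2) (x 0 i3) (x 0 i4) (x 0 i5).
Proof. by apply/rowP; apply: I5P; rewrite mxE. Qed.

Lemma normal_formE {R : realType} (x y : 'rV[R]_5) :
  normal_form x y = x 0 i1 * y 0 i5 + x 0 i2 * y 0 i4 + x 0 i3 * y 0 i3
                  + x 0 i4 * y 0 i2 + x 0 i5 * y 0 i1.
Proof.
rewrite /normal_form /matrix_form mxE big_I5 !mxE !big_I5 !mxE /=; ring.
Qed.

Lemma normal_mulE {R : realType} (p : coefs R) (x y : 'rV[R]_5) :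
  normal_mul p x y = row5
    (ca p * (x 0 i2 * y 0 i5 + x 0 i5 * y 0 i2)
     + cc p * (x 0 i3 * y 0 i4 + x 0 i4 * y 0 i3)
     + cd p * (x 0 i3 * y 0 i5 + x 0 i5 * y 0 i3) + cf p * (x 0 i4 * y 0 i4)
     + cg p * (x 0 i4 * y 0 i5 + x 0 i5 * y 0 i4) + ch p * (x 0 i5 * y 0 i5))
    (cb p * (x 0 i3 * y 0 i4 + x 0 i4 * y 0 i3)
     + cc p * (x 0 i3 * y 0 i5 + x 0 i5 * y 0 i3) + ce p * (x 0 i4 * y 0 i4)
     + cf p * (x 0 i4 * y 0 i5 + x 0 i5 * y 0 i4) + cg p * (x 0 i5 * y 0 i5))
    (cb p * (x 0 i4 * y 0 i4) + cc p * (x 0 i4 * y 0 i5 + x 0 i5 * y 0 i4)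
     + cd p * (x 0 i5 * y 0 i5))
    (ca p * (x 0 i5 * y 0 i5)) 0.
Proof. by apply/rowP; apply: I5P; rewrite !mxE /= !big_I5 /=; ring. Qed.

Lemma normal_mul_row5 {R : realType} (p : coefs R) (x1 x2 x3 x4 x5 y1 y2 y3 y4 y5 : R) :
  normal_mul p (row5 x1 x2 x3 x4 x5) (row5 y1 y2 y3 y4 y5) = row5
    (ca p * (x2 * y5 + x5 * y2)
     + cc p * (x3 * y4 + x4 * y3)
     + cd p * (x3 * y5 + x5 * y3) + cf p * (x4 * y4)
     + cg p * (x4 * y5 + x5 * y4) + ch p * (x5 * y5))
    (cb p * (x3 * y4 + x4 * y3)
     + cc p * (x3 * y5 + x5 * y3) + ce p * (x4 * y4)
     + cf p * (x4 * y5 + x5 * y4) + cg p * (x5 * y5))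
    (cb p * (x4 * y4) + cc p * (x4 * y5 + x5 * y4)
     + cd p * (x5 * y5))
    (ca p * (x5 * y5)) 0.
Proof. by rewrite normal_mulE !mxE. Qed.

Lemma normal_cubicE {R : realType} (p : coefs R) (x : 'rV[R]_5) :
  normal_form (normal_mul p x x) x =
    3 * ca p * (x 0 i2 * x 0 i5 ^+ 2) + 3 * cb p * (x 0 i3 * x 0 i4 ^+ 2)
    + 6 * cc p * (x 0 i3 * x 0 i4 * x 0 i5) + 3 * cd p * (x 0 i3 * x 0 i5 ^+ 2)
    + ce p * x 0 i4 ^+ 3 + 3 * cf p * (x 0 i4 ^+ 2 * x 0 i5)
    + 3 * cg p * (x 0 i4 * x 0 i5 ^+ 2) + ch p * x 0 i5 ^+ 3.
Proof. rewrite normal_formE normal_mulE !mxE /=; ring. Qed.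

Definition commutative_metrised {R : realType} (mul : 'rV[R]_5 -> 'rV[R]_5 -> 'rV[R]_5)
    (g : 'rV[R]_5 -> 'rV[R]_5 -> R) : Prop :=
  [/\ (forall x, linear (mul x)), commutative mul & is_metrised mul g].

Lemma normal_metrised {R : realType} (p : coefs R) :
  commutative_metrised (normal_mul p) normal_form.
Proof.
split; first by move=> x k y z; rewrite !normal_mulE; apply/rowP;
  apply: I5P; rewrite !mxE /=; ring.
  by move=> x y; rewrite !normal_mulE; apply/rowP; apply: I5P; rewrite !mxE /=; ring.
split; last first.
  move=> x x0; rewrite (row5K x); apply/rowP; apply: I5P; rewrite !mxE /=.
  - by have := x0 (delta_mx 0 i5); rewrite normal_formE !mxE /= => <-; ring.
  - by have := x0 (delta_mx 0 i4); rewrite normal_formE !mxE /= => <-; ring.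
  - by have := x0 (delta_mx 0 i3); rewrite normal_formE !mxE /= => <-; ring.
  - by have := x0 (delta_mx 0 i2); rewrite normal_formE !mxE /= => <-; ring.
  - by have := x0 (delta_mx 0 i1); rewrite normal_formE !mxE /= => <-; ring.
split.
- by move=> x k y z; rewrite !normal_formE !mxE /=; rewrite /GRing.scale /=; ring.
- by move=> x k y z; rewrite !normal_formE !mxE /=; rewrite /GRing.scale /=; ring.
- by move=> x y; rewrite !normal_formE; ring.
- by move=> u v w; rewrite !normal_formE !normal_mulE !mxE /=; ring.
Qed.

(* The hypotheses make A lower triangular in blocks of sizes 2, 1, 2. *)
Lemma det_block212 {R : realType} (A : 'M[R]_5) :
  (forall i j : 'I_5, (i < 2)%N -> (2 <= j)%N -> A i j = 0) ->
  A i3 i4 = 0 -> A i3 i5 = 0 ->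
  \det A = (A i1 i1 * A i2 i2 - A i1 i2 * A i2 i1) * A i3 i3
         * (A i4 i4 * A i5 i5 - A i4 i5 * A i5 i4).
Proof.
move=> A0 A34 A35.
have det2 (B : 'M[R]_2) : \det B = B 0 0 * B 1 1 - B 0 1 * B 1 0.
  rewrite (expand_det_row _ 0) !big_ord_recl big_ord0 /cofactor !det_mx11 !mxE /=.
  rewrite /= !addn0 expr0 expr1 mul1r mulN1r addr0 mulrN.
  by congr (B _ _ * B _ _ - B _ _ * B _ _); apply: val_inj.
pose B : 'M[R]_(2 + (1 + 2)) := A.
have -> : \det A = \det B by [].
have ur0 : ursubmx B = 0.
  by apply/matrixP => i j; rewrite !mxE; apply: A0; rewrite /= ?ltn_ord // leq_addr.
rewrite -(submxK B) ur0 det_lblock.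
set C := drsubmx B.
have urC0 : ursubmx C = 0.
  apply/matrixP => i j; rewrite !mxE !ord1.
  by case: j => [[|[|//]]] ?; [rewrite -[RHS]A34|rewrite -[RHS]A35];
    congr (A _ _); apply: val_inj.
rewrite -(submxK C) urC0 det_lblock !det2 det_mx11 !mxE mulrA.
by congr ((A _ _ * A _ _ - A _ _ * A _ _) * A _ _ * (A _ _ * A _ _ - A _ _ * A _ _));
  apply: val_inj.
Qed.

Section CommutativeMetrised.

Context {R : realType} {mul : 'rV[R]_5 -> 'rV[R]_5 -> 'rV[R]_5}
  {g : 'rV[R]_5 -> 'rV[R]_5 -> R} (mul_metrised : commutative_metrised mul g).

Lemma cm_mulC : commutative mul. Proof. by case: mul_metrised. Qed.

Lemma cm_mulDr (x y z : 'rV[R]_5) : mul x (y + z) = mul x y + mul x z.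
Proof. by case: mul_metrised => /(_ x 1 y z); rewrite !scale1r. Qed.

Lemma cm_mulDl (x y z : 'rV[R]_5) : mul (y + z) x = mul y x + mul z x.
Proof. by rewrite !(cm_mulC _ x) cm_mulDr. Qed.

Lemma cm_mulr0 x : mul x 0 = 0.
Proof. by apply: (addrI (mul x 0)); rewrite -cm_mulDr !addr0. Qed.

Lemma cm_mulZr k (x y : 'rV[R]_5) : mul x (k *: y) = k *: mul x y.
Proof. by case: mul_metrised => /(_ x k y 0); rewrite cm_mulr0 !addr0. Qed.

Lemma cm_mulZl k (x y : 'rV[R]_5) : mul (k *: y) x = k *: mul y x.
Proof. by rewrite !(cm_mulC _ x) cm_mulZr. Qed.

Lemma cm_formC (x y : 'rV[R]_5) : g x y = g y x.
Proof. by case: mul_metrised => _ _ [[]]. Qed.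

Lemma cm_formA u v w : g (mul u v) w = g u (mul v w).
Proof. by case: mul_metrised => _ _ [[]]. Qed.

Lemma cm_formDr (x y z : 'rV[R]_5) : g x (y + z) = g x y + g x z.
Proof. by case: mul_metrised => _ _ [[/(_ x 1 y z) + _ _ _ _]]; rewrite scale1r mul1r. Qed.

Lemma cm_formDl (x y z : 'rV[R]_5) : g (y + z) x = g y x + g z x.
Proof. by rewrite !(cm_formC _ x) cm_formDr. Qed.

Lemma cm_formr0 x : g x 0 = 0.
Proof. by apply: (addrI (g x 0)); rewrite -cm_formDr !addr0. Qed.

Lemma cm_form0r x : g 0 x = 0.
Proof. by rewrite cm_formC cm_formr0. Qed.

Lemma cm_formZr k (x y : 'rV[R]_5) : g x (k *: y) = k * g x y.
Proof. by case: mul_metrised => _ _ [[/(_ x k y 0) + _ _ _ _]]; rewrite cm_formr0 !addr0. Qed.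

Lemma cm_formZl k (x y : 'rV[R]_5) : g (k *: y) x = k * g y x.
Proof. by rewrite !(cm_formC _ x) cm_formZr. Qed.

Lemma cm_nondegenerate x : (forall y, g x y = 0) -> x = 0.
Proof. by case: mul_metrised => _ _ [_]; apply. Qed.

Lemma cm_form_inj x y : (forall z, g x z = g y z) -> x = y.
Proof.
move=> gxy; apply/eqP; rewrite -subr_eq0; apply/eqP/cm_nondegenerate => z.
by rewrite cm_formDl -scaleN1r cm_formZl gxy mulN1r subrr.
Qed.

Lemma cm_polar2 (x y : 'rV[R]_5) : 2 * g x y = g (x + y) (x + y) - g x x - g y y.
Proof. rewrite !(cm_formDl, cm_formDr) (cm_formC y x); ring. Qed.

Lemma cm_polar3 (x y z : 'rV[R]_5) :
  let q u := g (mul u u) u in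
  6 * g (mul x y) z
    = q (x + y + z) - q (x + y) - q (x + z) - q (y + z) + q x + q y + q z.
Proof.
(* These two transpositions generate the full symmetry of the trilinear form; [P1] and [P2] then
   bring the terms with a repeated vector to one shape. *)
have C12 u v w : g (mul u v) w = g (mul v u) w by rewrite cm_mulC.
have C13 u v w : g (mul u v) w = g (mul w v) u.
  by rewrite cm_formA cm_formC cm_mulC.
have P1 u v : g (mul v u) u = g (mul u u) v by rewrite C13.
have P2 u v : g (mul u v) u = g (mul u u) v by rewrite C12 C13.
rewrite /= !(cm_mulDl, cm_mulDr, cm_formDl, cm_formDr).
rewrite !(P1 x y, P2 x y, P1 x z, P2 x z, P1 y x, P2 y x, P1 y z, P2 y z, P1 z x, P2 z x, P1 z y, P2 z y).
rewrite (C12 y z x) (C13 z y x) (C13 y x z) (C12 z x y) (C13 x z y) (C12 y z x) (C13 z y x).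
ring.
Qed.

End CommutativeMetrised.

(* The rows of M are the new basis; by polarisation it is enough to compare the
   quadratic and the cubic forms. *)
Definition presents {R : realType} (mul : 'rV[R]_5 -> 'rV[R]_5 -> 'rV[R]_5)
    (g : 'rV[R]_5 -> 'rV[R]_5 -> R) (M : 'M[R]_5) (p : coefs R) : Prop :=
  [/\ \det M = 1,
      forall x, g (x *m M) (x *m M) = normal_form x x &
      forall x, g (mul (x *m M) (x *m M)) (x *m M)
                = normal_form (normal_mul p x x) x].

(** * Base changes and unimodular isomorphisms *)

Section Presents.

Context {R : realType} {mul : 'rV[R]_5 -> 'rV[R]_5 -> 'rV[R]_5}
  {g : 'rV[R]_5 -> 'rV[R]_5 -> R} (mul_metrised : commutative_metrised mul g).

Lemma presents_unit M p : presents mul g M p -> M \in unitmx.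
Proof. by case=> detM _ _; rewrite unitmxE detM unitr1. Qed.

Lemma presents_form M p : presents mul g M p ->
  forall x y, g (x *m M) (y *m M) = normal_form x y.
Proof.
case=> _ gM _ x y; apply: (mulfI (_ : 2 != 0 :> R)); first by rewrite pnatr_eq0.
by rewrite (cm_polar2 mul_metrised) (cm_polar2 (normal_metrised p)) -mulmxDl !gM.
Qed.

Lemma presents_mul M p : presents mul g M p ->
  forall x y, mul (x *m M) (y *m M) = normal_mul p x y *m M.
Proof.
move=> Mp x y; apply: (cm_form_inj mul_metrised) => z.
have [_ _ TM] := Mp.
rewrite -[z](mulmxKV (presents_unit Mp)); move: (z *m invmx M) => {}z.
rewrite (presents_form Mp).
apply: (mulfI (_ : 6 != 0 :> R)); first by rewrite pnatr_eq0.
by rewrite (cm_polar3 mul_metrised) (cm_polar3 (normal_metrised p)) -!mulmxDl !TM.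
Qed.

Lemma presents_isomorphic M p : presents mul g M p ->
  unimodularly_isomorphic mul g (normal_mul p) normal_form.
Proof.
(* [M] takes normal coordinates to vectors, so the isomorphism onto the normal algebra is its
   inverse. *)
move=> Mp; have Mu := presents_unit Mp; exists (fun x => x *m invmx M).
  split.
  - by move=> k x y; rewrite mulmxDl scalemxAl.
  - by exists (mulmxr M) => x; rewrite /= ?mulmxK ?mulmxKV.
  - move=> x y; rewrite -{1}[x](mulmxKV Mu) -{1}[y](mulmxKV Mu) (presents_mul Mp).
    by rewrite mulmxK.
  - by move=> x y; rewrite -(presents_form Mp) !mulmxKV.
rewrite /unimodular.
have -> : lin1_mx (fun x : 'rV[R]_5 => x *m invmx M) = invmx M.
  by apply/matrixP => i j; rewrite mxE -rowE mxE.
by rewrite det_inv; case: Mp => -> _ _; rewrite invr1.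
Qed.

Lemma isomorphic_presents p :
  unimodularly_isomorphic mul g (normal_mul p) normal_form ->
  exists M, presents mul g M p.
Proof.
case=> f [f_lin f_bij f_mul f_form] detf.
have fE x : f x = x *m lin1_mx f.
  pose fl : {linear 'rV[R]_5 -> 'rV[R]_5} :=
    HB.pack f (GRing.isLinear.Build R _ _ _ f f_lin).
  by rewrite -[f]/(fl : _ -> _) mul_rV_lin1.
have fu : lin1_mx f \in unitmx by rewrite unitmxE detf unitr1.
have fK x : f (x *m invmx (lin1_mx f)) = x by rewrite fE mulmxKV.
exists (invmx (lin1_mx f)); split.
- by rewrite det_inv detf invr1.
- by move=> x; rewrite -f_form fK.
- by move=> x; rewrite -f_form f_mul fK.
Qed.

Lemma presents_trans M p A q :
  presents mul g M p -> presents (normal_mul p) normal_form A q ->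
  presents mul g (A *m M) q.
Proof.
move=> Mp [detA gA TA]; split.
- by rewrite det_mulmx detA; case: Mp => -> _ _; rewrite mulr1.
- by move=> x; rewrite mulmxA (presents_form Mp).
- by move=> x; rewrite mulmxA (presents_mul Mp) (presents_form Mp).
Qed.

Lemma presents_quotient M p N q :
  presents mul g M p -> presents mul g N q ->
  presents (normal_mul p) normal_form (N *m invmx M) q.
Proof.
move=> Mp Nq; have Mu := presents_unit Mp; split.
- rewrite det_mulmx det_inv; case: Mp => -> _ _; case: Nq => -> _ _.
  by rewrite invr1 mulr1.
- by move=> x; rewrite -(presents_form Mp) mulmxA mulmxKV // (presents_form Nq).
- move=> x; rewrite -(presents_form Mp) -(presents_mul Mp) mulmxA mulmxKV //.
  by case: Nq => _ _ ->.
Qed.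

End Presents.

(** * Reduction of the coefficients to a normal form *)

Definition mx5 {R : realType} (r1 r2 r3 r4 r5 : 'rV[R]_5) : 'M[R]_5 :=
  \matrix_(i, j) (nth 0 [:: r1; r2; r3; r4; r5] i) 0 j.

Section Reduction.

Context {R : realType}.
Implicit Types p q r : coefs R.

Definition reduces p q : Prop :=
  exists A, presents (normal_mul p) normal_form A q.

Lemma reduces_trans p q r : reduces p q -> reduces q r -> reduces p r.
Proof.
move=> [A Aq] [B Br]; exists (B *m A).
exact: (presents_trans (normal_metrised p) Aq Br).
Qed.

(** Substituting x3 + u x4 + v x5 for x3 adds 3 (u x4 + v x5) q to C. The first two coordinates are
    corrected so that the metric is kept; when [a] is non-zero, the correction of x2 also enters
    [d], [g] and [h], and [z] moves [h] alone. *)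
Lemma reduces_shear (a b c d e f g h u v z d' e' f' g' h' : R) :
  d' = d - a * u -> e' = e + 3 * b * u -> f' = f + 2 * c * u + b * v ->
  g' = g + u * d + 2 * c * v - a * u ^+ 2 / 2 ->
  h' = h + 3 * v * d - 3 * a * u * v + 3 * a * z ->
  reduces (Coefs a b c d e f g h) (Coefs a b c d' e' f' g' h').
Proof.
move=> -> -> -> -> ->.
exists (mx5 (row5 1 0 0 0 0) (row5 0 1 0 0 0) (row5 (- v) (- u) 1 0 0)
           (row5 (- z) (- u ^+ 2 / 2) u 1 0) (row5 (- v ^+ 2 / 2) (z - u * v) v 0 1)).
split.
- rewrite det_block212; try by rewrite !mxE.
    by rewrite !mxE /=; ring.
  by apply: I5P => //; apply: I5P => //; rewrite !mxE.
- by move=> x; rewrite !normal_formE !mxE !big_I5 !mxE /=; field.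
- by move=> x; rewrite !normal_cubicE !mxE !big_I5 !mxE /=; field.
Qed.

(** A linear substitution in x4, x5 is accompanied by the contragredient one in x1, x2, which keeps
    the metric and the volume. When [a] is non-zero, [a * m = 0] sends x5 to a multiple of itself,
    so that a x2 x5^2 keeps its shape. *)
Lemma reduces_linear (a b c d e f g h k l m n a' b' c' d' e' f' g' h' : R) :
  k * n - l * m != 0 -> a * m = 0 ->
  a' = a * n ^+ 3 / (k * n - l * m) ->
  b' = b * k ^+ 2 + 2 * c * k * m + d * m ^+ 2 ->
  c' = b * k * l + c * (k * n + l * m) + d * m * n ->
  d' = b * l ^+ 2 + 2 * c * l * n + d * n ^+ 2 ->
  e' = e * k ^+ 3 + 3 * f * k ^+ 2 * m + 3 * g * k * m ^+ 2 + h * m ^+ 3 ->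
  f' = e * k ^+ 2 * l + f * (k ^+ 2 * n + 2 * k * l * m)
       + g * (l * m ^+ 2 + 2 * k * m * n) + h * m ^+ 2 * n ->
  g' = e * k * l ^+ 2 + f * (l ^+ 2 * m + 2 * k * l * n)
       + g * (k * n ^+ 2 + 2 * l * m * n) + h * m * n ^+ 2 ->
  h' = e * l ^+ 3 + 3 * f * l ^+ 2 * n + 3 * g * l * n ^+ 2 + h * n ^+ 3 ->
  reduces (Coefs a b c d e f g h) (Coefs a' b' c' d' e' f' g' h').
Proof.
move=> D0 am -> -> -> -> -> -> -> ->.
set D := k * n - l * m.
exists (mx5 (row5 (k / D) (- m / D) 0 0 0) (row5 (- l / D) (n / D) 0 0 0)
           (row5 0 0 1 0 0) (row5 0 0 0 k m) (row5 0 0 0 l n)).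
split.
- rewrite det_block212; try by rewrite !mxE.
    by rewrite !mxE /= /D; field.
  by apply: I5P => //; apply: I5P => //; rewrite !mxE.
- by move=> x; rewrite !normal_formE !mxE !big_I5 !mxE /= /D; field.
- move=> x; rewrite !normal_cubicE !mxE !big_I5 !mxE /=.
  have [a0|m0] : a = 0 \/ m = 0 by move/eqP: am; rewrite mulf_eq0 => /orP[] /eqP; auto.
    by rewrite a0 /D; field.
  move: D0; rewrite /D m0 mulr0 subr0 mulf_eq0 negb_or => /andP[k0 n0].
  by field; rewrite k0 n0.
Qed.

(* Either the cubic form does not involve x3, so that e3 spans an ideal, or x5
   occurs only in x5 ^ 3, so that e1 and e5 span an ideal. *)
Definition split_coefs p : Prop :=
  [/\ cb p = 0, cc p = 0 & cd p = 0] \/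
  [/\ ca p = 0, cc p = 0, cd p = 0, cf p = 0 & cg p = 0].

(** The reduction is pure algebra on the coefficients, so it may end in a split algebra;
    indecomposability excludes this outcome only in the final theorem. *)
Definition reducible p : Prop :=
  exists2 q, reduces p q & normal_coefs q \/ split_coefs q.

Lemma reducible_trans p q : reduces p q -> reducible q -> reducible p.
Proof.
by move=> pq [r qr ?]; exists r => //; apply: reduces_trans pq qr.
Qed.

Lemma reduces_refl p : reduces p p.
Proof.
exists 1%:M; split; first exact: det1.
  by move=> x; rewrite mulmx1.
by move=> x; rewrite mulmx1.
Qed.

Lemma reducible_split p : split_coefs p -> reducible p.
Proof. by move=> ?; exists p; [exact: reduces_refl|right]. Qed.

Lemma reducible_normal p : normal_coefs p -> reducible p.
Proof. by move=> ?; exists p; [exact: reduces_refl|left]. Qed.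

(** The intermediate value theorem applies on [- b, b] with b = 1 + |x|, because b^3 is at least
    |x|. *)
Lemma cube_root (x : R) : exists t : R, t ^+ 3 = x.
Proof.
pose n : R := `|x|; pose b := 1 + n.
have n0 : 0 <= n by exact: normr_ge0.
have xn : x <= n by exact: ler_norm.
have nx : - n <= x by have := ler_norm (- x); rewrite normrN -/n; lra.
have nb : n <= b ^+ 3.
  have n2 := mulr_ge0 n0 n0; have n3 := mulr_ge0 n0 n2.
  have -> : b ^+ 3 = 1 + 3 * n + 3 * (n * n) + n * (n * n) by rewrite /b; ring.
  lra.
have [| |t _] := @poly_ivt R ('X^3 - x%:P) (- b) b.
- by rewrite /b; lra.
- rewrite !hornerE; have -> : (- b) ^+ 3 = - b ^+ 3 by ring.
  by apply/andP; split; lra.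
by rewrite rootE !hornerE subr_eq0 => /eqP; exists t.
Qed.

Lemma sign_neq0 (s : R) : is_sign s -> s != 0.
Proof. by case=> ->; rewrite ?oppr_eq0 oner_eq0. Qed.

Lemma sign_sqr (s : R) : is_sign s -> s ^+ 2 = 1.
Proof. by case=> ->; rewrite ?sqrrN expr1n. Qed.

Lemma sign_normP (x : R) : x != 0 ->
  exists s n : R, [/\ is_sign s, 0 < n & x = s * n].
Proof.
move=> x0; exists (Num.sg x), `|x|; split; rewrite ?normr_gt0 -?numEsg //.
by rewrite /is_sign; move: x0; case: sgrP => _ x0; [case/negP: x0|left|right].
Qed.

(** Here q = s x4^2, so shears can cancel [e] and [f]. If [h] is non-zero, adding a multiple of x4
    to x5 first removes [g]; then x5 survives only in x5^3 and the algebra splits. It splits too if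
    [g] and [h] vanish. Otherwise scaling takes [g] to 1. *)
Lemma reducible_rank1 (s e f g h : R) :
  is_sign s -> reducible (Coefs 0 s 0 0 e f g h).
Proof.
move=> sS; have s0 := sign_neq0 sS; have s2 := sign_sqr sS.
(* A sign is its own inverse, so a shear by [- (s * f')] cancels [f']. *)
have f_killed (e' f' g' : R) : f' - s ^+ 2 * f' = 0 by rewrite s2; ring.
have [h0|h0] := eqVneq h 0; last first.
  pose f1 := f * (1 : R) + g * (2 * (- (g / h))) + h * (- (g / h)) ^+ 2.
  pose e1 := e + 3 * f * (- (g / h)) + 3 * g * (- (g / h)) ^+ 2
             + h * (- (g / h)) ^+ 3.
  apply: (@reducible_trans _ (Coefs 0 s 0 0 e1 f1 0 h)).
    apply: (@reduces_linear _ _ _ _ _ _ _ _ 1 0 (- (g / h)) 1) => //=;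
      rewrite /e1 /f1; try by field.
    by rewrite mul1r mul0r subr0 oner_eq0.
  apply: (@reducible_trans _ (Coefs 0 s 0 0 e1 0 0 h)).
    apply: (@reduces_shear _ _ _ _ _ _ _ _ 0 (- (s * f1)) 0); try by ring.
    by rewrite -[LHS](f_killed 0 f1 0); ring.
  by apply: reducible_split; right.
rewrite h0; have [g0|g0] := eqVneq g 0.
  rewrite g0; apply: (@reducible_trans _ (Coefs 0 s 0 0 e 0 0 0)).
    apply: (@reduces_shear _ _ _ _ _ _ _ _ 0 (- (s * f)) 0); try by ring.
    by rewrite -[LHS](f_killed 0 f 0); ring.
  by apply: reducible_split; right.
apply: (@reducible_trans _ (Coefs 0 s 0 0 0 0 g 0)).
  apply: (@reduces_shear _ _ _ _ _ _ _ _ (- (s * e / 3)) (- (s * f)) 0); try by ring.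
    by rewrite -[LHS](f_killed 0 e 0); field.
  by rewrite -[LHS](f_killed 0 f 0); ring.
apply: reducible_trans (reducible_normal (normal1 sS)).
have [t [n [tS n0 ->]]] := sign_normP g0.
have t2 := sign_sqr tS.
have [w w0 ->] : exists2 w, w != 0 & n = w ^+ 2.
  by exists (Num.sqrt n); rewrite ?sqr_sqrtr ?ltW // gt_eqF // sqrtr_gt0.
have t0 : t != 0 by rewrite -sqrf_eq0 t2 oner_eq0.
apply: (@reduces_linear _ _ _ _ _ _ _ _ t 0 0 w^-1); try by ring.
- by rewrite mulr0 subr0 mulf_neq0 ?invr_eq0.
- by rewrite t2; ring.
- by transitivity (t ^+ 2); [rewrite t2|field].
Qed.

(** With z = k + i l the equation reads A Im z^3 + B Re z^3 = 0, so z^3 has a prescribed direction.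
    Dividing by k^3 gives a cubic in t = l / k. At t = 1 / sqrt 3 and t = - 1 / sqrt 3 the factor 1
    - 3 t^2 of [B] vanishes and the two values are opposite, hence there is a root in between. *)
Lemma trisection (A B : R) : exists k l : R,
  k ^+ 2 + l ^+ 2 = 1 /\
  A * (3 * k ^+ 2 * l - l ^+ 3) + B * (k ^+ 3 - 3 * k * l ^+ 2) = 0.
Proof.
wlog A0 : A B / 0 <= A => [th|].
  have [/th//|/ltW A0] := leP 0 A.
  have [|k [l [kl AB]]] := th (- A) (- B); first by lra.
  exists k, l; split=> //; rewrite -[RHS]oppr0 -[in RHS]AB; ring.
have [s s0 s2] : exists2 s : R, 0 < s & 3 * s ^+ 2 = 1.
  have r3 : 0 < Num.sqrt 3 :> R by rewrite sqrtr_gt0.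
  exists (Num.sqrt 3)^-1; first by rewrite invr_gt0.
  by rewrite exprVn sqr_sqrtr // divff // pnatr_eq0.
pose P : {poly R} := (3 * A) *: 'X - A *: 'X^3 + B%:P - (3 * B) *: 'X^2.
have PE t : P.[t] = A * (3 * t - t ^+ 3) + B * (1 - 3 * t ^+ 2).
  by rewrite !(hornerD, hornerN, hornerZ, hornerX, hornerXn, hornerC); ring.
have [| |t _] := @poly_ivt R P (- s) s; first by lra.
  rewrite !PE; have -> : 3 * (- s) ^+ 2 = 1 by rewrite -[RHS]s2; ring.
  rewrite s2 subrr !mulr0 !addr0.
  have -> : 3 * s - s ^+ 3 = s * (8 / 3) by
     transitivity (s * (3 - (3 * s ^+ 2) / 3)); [field|rewrite s2; field].
  have -> : 3 * - s - (- s) ^+ 3 = - (s * (8 / 3)) by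
     transitivity (- (s * (3 - (3 * s ^+ 2) / 3))); [field|rewrite s2; field].
  have : 0 <= A * (s * (8 / 3)) by apply: mulr_ge0 => //; apply: mulr_ge0; lra.
  by move=> ?; apply/andP; split; lra.
rewrite rootE PE => /eqP t0.
have t1 : 0 < 1 + t ^+ 2 by have := sqr_ge0 t; lra.
pose k := (Num.sqrt (1 + t ^+ 2))^-1.
have k2 : k ^+ 2 * (1 + t ^+ 2) = 1 by rewrite exprVn sqr_sqrtr ?mulVf ?gt_eqF ?ltW.
exists k, (k * t); split; first by rewrite -[RHS]k2; ring.
by rewrite -[RHS](mulr0 (k ^+ 3)) -[in RHS]t0; ring.
Qed.

(** Modulo multiples of the definite form q, a binary cubic is represented by a harmonic one, on
    which a rotation acts through three times its angle. [trisection] supplies a rotation after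
    which [h] can be killed, and the half turn makes the remaining coefficient non-negative. *)
Lemma reducible_definite (s e f g h : R) :
  is_sign s -> reducible (Coefs 0 s 0 s e f g h).
Proof.
move=> sS; have s2 := sign_sqr sS.
have killed (f' : R) : f' - s ^+ 2 * f' = 0 by rewrite s2; ring.
have kill (e1 f1 g1 h1 : R) : reduces (Coefs 0 s 0 s e1 f1 g1 h1)
    (Coefs 0 s 0 s (e1 - 3 * g1) 0 0 (h1 - 3 * f1)).
  apply: (@reduces_shear _ _ _ _ _ _ _ _ (- (s * g1)) (- (s * f1)) 0); try by ring.
  - by transitivity (e1 - 3 * s ^+ 2 * g1); [rewrite s2|]; ring.
  - by rewrite -[LHS](killed f1); ring.
  - by rewrite -[LHS](killed g1); field.
  - by transitivity (h1 - 3 * s ^+ 2 * f1); [rewrite s2|]; ring.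
apply: reducible_trans (kill _ _ _ _) _.
move: (e - 3 * g) (h - 3 * f) => A B {e f g h}.
have [k [l [kl AB]]] := trisection A B.
have rot (k' l' e' h' : R) : k' ^+ 2 + l' ^+ 2 = 1 -> exists f1 g1 : R,
    reduces (Coefs 0 s 0 s e' 0 0 h') (Coefs 0 s 0 s
      (e' * k' ^+ 3 + h' * l' ^+ 3) f1 g1 (- e' * l' ^+ 3 + h' * k' ^+ 3)) /\
    f1 = - e' * k' ^+ 2 * l' + h' * l' ^+ 2 * k' /\
    g1 = e' * k' * l' ^+ 2 + h' * l' * k' ^+ 2.
  move=> kl'; do 2!eexists; split; last by split; reflexivity.
  apply: (@reduces_linear _ _ _ _ _ _ _ _ k' (- l') l' k'); try by ring.
  - have -> : k' * k' - - l' * l' = 1 by rewrite -[RHS]kl'; ring.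
    exact: oner_neq0.
  - by transitivity (s * (k' ^+ 2 + l' ^+ 2)); [rewrite kl'|]; ring.
  - by transitivity (s * (k' ^+ 2 + l' ^+ 2)); [rewrite kl'|]; ring.
have [f1 [g1 [red [f1E g1E]]]] := rot k l A B kl.
apply: reducible_trans red _; apply: reducible_trans (kill _ _ _ _) _.
have -> : - A * l ^+ 3 + B * k ^+ 3 - 3 * f1 = 0 by rewrite f1E -[RHS]AB; ring.
move: (_ - 3 * g1) => {}A {B k l kl AB f1 g1 f1E g1E}.
have [A0|A0|->] := ltgtP A 0; last exact: reducible_normal (normal2 sS).
  have [|f1 [g1 [red [f1E g1E]]]] := rot (-1) 0 A 0; first by ring.
  apply: reducible_trans red _.
  have -> : f1 = 0 by rewrite f1E; ring.
  have -> : g1 = 0 by rewrite g1E; ring.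
  have -> : A * (-1) ^+ 3 + 0 * 0 ^+ 3 = - A by ring.
  have -> : - A * 0 ^+ 3 + 0 * (-1) ^+ 3 = 0 by ring.
  by apply/reducible_normal/normal3 => //; rewrite oppr_gt0.
exact/reducible_normal/normal3.
Qed.

(** Since q = 2 x4 x5, shears leave C = e x4^3 + h x5^3, which may still be changed by exchanging x4
    and x5 and by scaling them inversely to each other. If [e] and [h] are both non-zero, they are
    given the same absolute value and [e] is made positive; if one vanishes, the other becomes 0 or
    1. *)
Lemma reducible_hyperbolic (e f g h : R) : reducible (Coefs 0 0 1 0 e f g h).
Proof.
apply: (@reducible_trans _ (Coefs 0 0 1 0 e 0 0 h)).
  by apply: (@reduces_shear _ _ _ _ _ _ _ _ (- f / 2) (- g / 2) 0); field.
have scale (t e' h' : R) : t != 0 ->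
    reduces (Coefs 0 0 1 0 e' 0 0 h') (Coefs 0 0 1 0 (e' * t ^+ 3) 0 0 (h' / t ^+ 3)).
  move=> t0.
  apply: (@reduces_linear _ _ _ _ _ _ _ _ t 0 0 t^-1); try by field.
  by rewrite mulfV // mulr0 subr0 oner_neq0.
have swap (e' h' : R) :
    reduces (Coefs 0 0 1 0 e' 0 0 h') (Coefs 0 0 1 0 h' 0 0 e').
  apply: (@reduces_linear _ _ _ _ _ _ _ _ 0 1 1 0); try by ring.
  by rewrite !(mulr0, mul0r, mul1r) sub0r oppr_eq0 oner_neq0.
have one (e' : R) : reducible (Coefs 0 0 1 0 e' 0 0 0).
  have [->|e0] := eqVneq e' 0; first exact/reducible_normal/normal4.
  have [t tE] := cube_root e'^-1.
  have t0 : t != 0 by apply: contra_neq e0 => t0; rewrite -[e']invrK -tE t0 expr0n invr0.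
  apply: reducible_trans (scale t _ _ t0) _.
  by rewrite tE mulfV // mul0r; apply/reducible_normal/normal5.
have [->|e0] := eqVneq e 0; first by apply: reducible_trans (swap _ _) (one _).
have [->|h0] := eqVneq h 0; first exact: one.
have [s1 [n1 [s1S n1_gt0 ->]]] := sign_normP e0.
have [s2 [n2 [s2S n2_gt0 ->]]] := sign_normP h0.
have [w w_gt0 ->] : exists2 w, 0 < w & n2 = n1 * w ^+ 2.
  have n12 : 0 < n2 / n1 by rewrite divr_gt0.
  exists (Num.sqrt (n2 / n1)); first by rewrite sqrtr_gt0.
  by rewrite sqr_sqrtr ?ltW // mulrC divfK // gt_eqF.
have s1_neq0 := sign_neq0 s1S.
have w_neq0 : w != 0 by rewrite gt_eqF.
(* The factor w balances the absolute values, since w^2 = n2 / n1, and the sign [s1] makes the new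
   [e] positive. *)
have [t tE] := cube_root (s1 * w).
have t0 : t != 0 by have := mulf_neq0 s1_neq0 w_neq0; rewrite -tE expf_eq0.
apply: reducible_trans (scale t _ _ t0) _; rewrite tE.
have -> : s1 * n1 * (s1 * w) = n1 * w.
  by transitivity (s1 ^+ 2 * (n1 * w)); [ring|rewrite sign_sqr ?mul1r].
have -> : s2 * (n1 * w ^+ 2) / (s1 * w) = (s2 * s1) * (n1 * w).
  transitivity (s2 * n1 * w / s1); first by field; rewrite w_neq0 s1_neq0.
  by transitivity (s2 * n1 * w * s1 ^+ 2 / s1); [rewrite sign_sqr ?mulr1|field].
apply/reducible_normal/normal6; last by rewrite mulr_gt0.
by case: s1S s2S => -> [] ->; [left|right|right|left]; ring.
Qed.

(* Case analysis on the discriminant of q = b x4 ^ 2 + 2 c x4 x5 + d x5 ^ 2. *)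
Lemma reducible_ca0 (b c d e f g h : R) : reducible (Coefs 0 b c d e f g h).
Proof.
have lin (k l m n b' c' d' : R) : k * n - l * m != 0 ->
    b' = b * k ^+ 2 + 2 * c * k * m + d * m ^+ 2 ->
    c' = b * k * l + c * (k * n + l * m) + d * m * n ->
    d' = b * l ^+ 2 + 2 * c * l * n + d * n ^+ 2 ->
    (forall e f g h, reducible (Coefs 0 b' c' d' e f g h)) ->
    reducible (Coefs 0 b c d e f g h).
  move=> D0 bE cE dE red; apply: reducible_trans (red _ _ _ _).
  by apply: (@reduces_linear _ _ _ _ _ _ _ _ k l m n) => //; rewrite !mul0r.
have [b0|b0] := eqVneq b 0.
  rewrite b0 in lin *.
  have [c0|c0] := eqVneq c 0.
    rewrite c0 in lin *.
    have [->|d0] := eqVneq d 0; first by apply: reducible_split; left.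
    have [s [n [sS n0 dE]]] := sign_normP d0.
    have [w w0 nE] : exists2 w, w != 0 & n = w ^+ 2.
      by exists (Num.sqrt n); rewrite ?sqr_sqrtr ?ltW // gt_eqF // sqrtr_gt0.
    apply: (lin 0 1 w^-1 0 s 0 0); try by rewrite dE nE; field.
      by rewrite !(mul0r, mul1r) sub0r oppr_eq0 invr_eq0.
    by move=> *; apply: reducible_rank1.
  apply: (lin c^-1 (- (d / (2 * c))) 0 1 0 1 0); try by field.
    by rewrite mulr1 mulr0 subr0 invr_eq0.
  exact: reducible_hyperbolic.
have [s [n [sS n0 bE]]] := sign_normP b0.
have s0 := sign_neq0 sS; have s2 := sign_sqr sS.
have n0' : n != 0 by rewrite gt_eqF.
have [w w0 nE] : exists2 w, w != 0 & n = w ^+ 2.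
  by exists (Num.sqrt n); rewrite ?sqr_sqrtr ?ltW // gt_eqF // sqrtr_gt0.
have [lt|gt|eq] := ltgtP (b * d) (c ^+ 2).
- have [r r0 rE] : exists2 r, r != 0 & c ^+ 2 - b * d = r ^+ 2.
    have D0 : 0 < c ^+ 2 - b * d by rewrite subr_gt0.
    by exists (Num.sqrt (c ^+ 2 - b * d)); rewrite ?sqr_sqrtr ?ltW // gt_eqF // sqrtr_gt0.
  have dE : d = (c ^+ 2 - r ^+ 2) / b by rewrite -rE; field.
  (* The vectors (k, m) and (l, n) span the two real isotropic lines of q and are scaled so that
     their polar product is 1. *)
  apply: (lin ((c + r) / (b * r)) ((r - c) / (2 * r)) (- r^-1) (b / (2 * r)) 0 1 0);
    try by rewrite dE; field; rewrite ?r0 ?b0.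
  + have -> : (c + r) / (b * r) * (b / (2 * r)) - (r - c) / (2 * r) * (- r^-1) = r^-1.
      by field; rewrite r0 b0.
    by rewrite invr_eq0.
  + exact: reducible_hyperbolic.
- have [r r0 rE] : exists2 r, r != 0 & b * d - c ^+ 2 = r ^+ 2.
    have D0 : 0 < b * d - c ^+ 2 by rewrite subr_gt0.
    by exists (Num.sqrt (b * d - c ^+ 2)); rewrite ?sqr_sqrtr ?ltW // gt_eqF // sqrtr_gt0.
  have dE : d = (c ^+ 2 + r ^+ 2) / b by rewrite -[r ^+ 2]rE; field.
  rewrite bE nE in b0 dE lin *.
  (* Completing the square in x4 and scaling both variables gives s (x4^2 + x5^2). *)
  apply: (lin w^-1 (- (c / (s * w ^+ 2)) * (w / r)) 0 (w / r) s 0 s).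
  + by rewrite mulr0 subr0 !mulf_neq0 ?invr_eq0.
  + by field.
  + by field; rewrite w0 s0 r0.
  + transitivity (s ^+ 2 / s); first by field.
    by rewrite s2 dE; transitivity (s^-1 : R); rewrite ?mul1r //; field; rewrite w0 s0 r0.
  + by move=> *; apply: reducible_definite.
- have dE : d = c ^+ 2 / b by rewrite -eq; field.
  rewrite bE nE in b0 dE lin *.
  apply: (lin w^-1 (- (c / (s * w ^+ 2))) 0 1 s 0 0);
    try by rewrite ?dE; field; rewrite ?w0 ?s0.
    by rewrite mulr0 subr0 mulr1 invr_eq0.
  by move=> *; apply: reducible_rank1.
Qed.

Lemma reducible_ca_neq0 (a c d e f g h : R) :
  a != 0 -> a * e = c ^+ 2 -> reducible (Coefs a 0 c d e f g h).
Proof.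
move=> a0 ae; have eE : e = c ^+ 2 / a by rewrite -ae; field.
have [c0|c0] := eqVneq c 0.
  have e0 : e = 0 by rewrite eE c0; field.
  rewrite c0 e0.
  apply: (@reducible_trans _ (Coefs a 0 0 0 0 f (g + d ^+ 2 / (2 * a)) h)).
    by apply: (@reduces_shear _ _ _ _ _ _ _ _ (d / a) 0 0); field.
  by apply: reducible_split; left.
(* The shear by d1 / a that kills [d1] changes [f1] to f1 + 2 c d1 / a. With e = c^2 / a this is (5
   c^2 v + a f + 2 c d) / a, and [v] is its root, so [d] and [f] disappear together. *)
pose v := - (a * f + 2 * c * d) / (5 * c ^+ 2).
pose d1 := d + 2 * c * v.
pose f1 := e * v + f.
pose g1 := e * v ^+ 2 + 2 * f * v + g.
pose h1 := e * v ^+ 3 + 3 * f * v ^+ 2 + 3 * g * v + h.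
apply: (@reducible_trans _ (Coefs a 0 c d1 e f1 g1 h1)).
  apply: (@reduces_linear _ _ _ _ _ _ _ _ 1 v 0 1);
    rewrite ?/d1 ?/f1 ?/g1 ?/h1; try by [field|ring].
  by rewrite mulr0 subr0 mulr1 oner_neq0.
pose g2 := g1 + d1 ^+ 2 / (2 * a).
apply: (@reducible_trans _ (Coefs a 0 c 0 e 0 g2 h1)).
  apply: (@reduces_shear _ _ _ _ _ _ _ _ (d1 / a) 0 0);
    try by rewrite /g2; field.
  by rewrite /f1 /d1 eE /v; field; rewrite c0 a0.
apply: (@reducible_trans _ (Coefs a 0 c 0 e 0 0 h1)).
  by apply: (@reduces_shear _ _ _ _ _ _ _ _ 0 (- (g2 / (2 * c))) 0); field.
apply: (@reducible_trans _ (Coefs a 0 c 0 e 0 0 0)).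
  by apply: (@reduces_shear _ _ _ _ _ _ _ _ 0 0 (- (h1 / (3 * a)))); field.
move=> {v d1 f1 g1 h1 g2}.
have [t tE] := cube_root e^-1.
have e0 : e != 0 by rewrite eE mulf_neq0 ?invr_eq0 // sqrf_eq0.
have t0 : t != 0 by move: e0; rewrite -invr_eq0 -tE expf_eq0.
have et : e * t ^+ 3 = 1 by rewrite tE mulfV.
apply: reducible_trans (reducible_normal normal7).
(* The two scalings normalise [e] and [c]; [a] then becomes 1 as well, because a e = c^2. *)
apply: (@reduces_linear _ _ _ _ _ _ _ _ t 0 0 (c * t)^-1); try by ring.
- by rewrite mulr0 subr0 mulf_neq0 ?invr_eq0 // mulf_neq0.
- rewrite -[LHS]et; apply: (mulfI (_ : c ^+ 2 != 0)); first by rewrite sqrf_eq0.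
  transitivity (c ^+ 2); first by rewrite et mulr1.
  by transitivity (a / t ^+ 3); [rewrite tE invrK ae|field; rewrite ?c0 ?t0].
- by field; rewrite c0 t0.
- by rewrite -[LHS]et; ring.
Qed.

End Reduction.

(** * Uniqueness *)

Section Uniqueness.

Context {R : realType}.
Implicit Types p q : coefs R.

Local Notation "''e_' i" := (delta_mx 0 i : 'rV[R]_5) (at level 8, i at level 2).

Lemma presents_annihilator p q A (x : 'rV[R]_5) :
  presents (normal_mul p) normal_form A q -> (forall y, normal_mul q x y = 0) ->
  forall y, normal_mul p (x *m A) y = 0.
Proof.
move=> Aq x0 y; rewrite -[y](mulmxKV (presents_unit Aq)).
by rewrite (presents_mul (normal_metrised p) Aq) x0 mul0mx.
Qed.

Lemma presents_gram p q A : presents (normal_mul p) normal_form A q ->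
  forall i j, A i i1 * A j i5 + A i i2 * A j i4 + A i i3 * A j i3
    + A i i4 * A j i2 + A i i5 * A j i1 = (i + j == 4)%N%:R.
Proof.
move=> Aq i j; have := presents_form (normal_metrised p) Aq 'e_i 'e_j.
rewrite !normal_formE -!rowE !mxE => ->; move: i j.
by apply: I5P; apply: I5P; rewrite /= !(mulr0, mul0r, addr0, add0r, mulr1).
Qed.

Lemma normal_trilinearE p (x y z : 'rV[R]_5) :
  normal_form (normal_mul p x y) z =
    ca p * (x 0 i2 * y 0 i5 * z 0 i5 + x 0 i5 * y 0 i2 * z 0 i5
            + x 0 i5 * y 0 i5 * z 0 i2)
    + cb p * (x 0 i3 * y 0 i4 * z 0 i4 + x 0 i4 * y 0 i3 * z 0 i4
            + x 0 i4 * y 0 i4 * z 0 i3)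
    + cc p * (x 0 i3 * (y 0 i4 * z 0 i5 + y 0 i5 * z 0 i4)
            + y 0 i3 * (x 0 i4 * z 0 i5 + x 0 i5 * z 0 i4)
            + z 0 i3 * (x 0 i4 * y 0 i5 + x 0 i5 * y 0 i4))
    + cd p * (x 0 i3 * y 0 i5 * z 0 i5 + x 0 i5 * y 0 i3 * z 0 i5
            + x 0 i5 * y 0 i5 * z 0 i3)
    + ce p * (x 0 i4 * y 0 i4 * z 0 i4)
    + cf p * (x 0 i4 * y 0 i4 * z 0 i5 + x 0 i4 * y 0 i5 * z 0 i4
            + x 0 i5 * y 0 i4 * z 0 i4)
    + cg p * (x 0 i4 * y 0 i5 * z 0 i5 + x 0 i5 * y 0 i4 * z 0 i5
            + x 0 i5 * y 0 i5 * z 0 i4)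
    + ch p * (x 0 i5 * y 0 i5 * z 0 i5).
Proof. by rewrite normal_formE normal_mulE !mxE /=; ring. Qed.

Lemma annihilator1 q (y : 'rV[R]_5) : normal_mul q 'e_i1 y = 0.
Proof. by rewrite normal_mulE; apply/rowP; apply: I5P; rewrite !mxE /=; ring. Qed.

Lemma annihilator2 q (y : 'rV[R]_5) : ca q = 0 -> normal_mul q 'e_i2 y = 0.
Proof.
by move=> a0; rewrite normal_mulE a0; apply/rowP; apply: I5P; rewrite !mxE /=; ring.
Qed.

Definition small_annihilator p : Prop :=
  forall x, (forall y, normal_mul p x y = 0) ->
  [/\ x 0 i3 = 0, x 0 i4 = 0 & x 0 i5 = 0].

(* The substitution x3 = y3 + u y4 + v y5, x4 = k y4 + l y5, x5 = m y4 + n y5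
   turns p into q. *)
Definition block_equivalent p q : Prop :=
  exists k l m n u v : R,
  [/\ k * n - l * m != 0,
      [/\ cb q = cb p * k ^+ 2 + 2 * cc p * k * m + cd p * m ^+ 2,
      cc q = cb p * k * l + cc p * (k * n + l * m) + cd p * m * n &
      cd q = cb p * l ^+ 2 + 2 * cc p * l * n + cd p * n ^+ 2],
      ce q = ce p * k ^+ 3 + 3 * cf p * k ^+ 2 * m + 3 * cg p * k * m ^+ 2
             + ch p * m ^+ 3 + 3 * u * cb q,
      cf q = ce p * k ^+ 2 * l + cf p * (k ^+ 2 * n + 2 * k * l * m)
       + cg p * (l * m ^+ 2 + 2 * k * m * n) + ch p * m ^+ 2 * n
       + 2 * u * cc q + v * cb q &
      cg q = ce p * k * l ^+ 2 + cf p * (l ^+ 2 * m + 2 * k * l * n)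
       + cg p * (k * n ^+ 2 + 2 * l * m * n) + ch p * m * n ^+ 2
       + u * cd q + 2 * v * cc q /\
      ch q = ce p * l ^+ 3 + 3 * cf p * l ^+ 2 * n + 3 * cg p * l * n ^+ 2
             + ch p * n ^+ 3 + 3 * v * cd q].

(** The base change carries the annihilating vectors e1, e2 of [q] into the span of e1, e2, so the
    first two rows end in zeros. Orthogonality then clears the last two entries of the third row,
    and the coefficients of [q] are read off from the lower right part. *)
Lemma presents_blocks p q A :
  presents (normal_mul p) normal_form A q ->
  small_annihilator p -> ca p = 0 -> ca q = 0 -> block_equivalent p q.
Proof.
move=> Aq small p0 q0.
have row0 i : (forall y, normal_mul q 'e_i y = 0) -> [/\ A i i3 = 0, A i i4 = 0 & A i i5 = 0].
  by move=> /(presents_annihilator Aq)/small; rewrite -rowE !mxE.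
have [A13 A14 A15] := row0 i1 (annihilator1 q).
have [A23 A24 A25] := row0 i2 (fun y => annihilator2 y q0).
have G := presents_gram Aq.
have G33 := G i3 i3; have G14 := G i1 i4; have G15 := G i1 i5.
have G24 := G i2 i4; have G25 := G i2 i5.
have G13 := G i1 i3; have G23 := G i2 i3.
rewrite /= ?(A13, A14, A15, A23, A24, A25) !(mul0r, addr0) in G14 G15 G24 G25 G13 G23.
pose d1 := A i1 i1 * A i2 i2 - A i1 i2 * A i2 i1.
pose d2 := A i4 i4 * A i5 i5 - A i4 i5 * A i5 i4.
(* The metric pairs the plane of e1, e2 with that of e4, e5, so the two diagonal blocks have inverse
   determinants. As \det A = 1, this will leave 1, and not -1, for the middle entry. *)
have d12 : d1 * d2 = 1.
  rewrite /d1 /d2; transitivity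
   ((A i1 i1 * A i5 i5 + A i1 i2 * A i5 i4) * (A i2 i1 * A i4 i5 + A i2 i2 * A i4 i4)
   - (A i1 i1 * A i4 i5 + A i1 i2 * A i4 i4) * (A i2 i1 * A i5 i5 + A i2 i2 * A i5 i4)).
    by ring.
  by rewrite G14 G15 G24 G25; ring.
have d1_neq0 : d1 != 0 by apply: contra_eq_neq d12 => ->; rewrite mul0r eq_sym oner_neq0.
have d2_neq0 : d2 != 0 by apply: contra_eq_neq d12 => ->; rewrite mulr0 eq_sym oner_neq0.
have A34 : A i3 i4 = 0.
  apply: (mulfI d1_neq0); rewrite mulr0.
  transitivity (A i1 i1 * (A i2 i1 * A i3 i5 + A i2 i2 * A i3 i4)
     - A i2 i1 * (A i1 i1 * A i3 i5 + A i1 i2 * A i3 i4)); first by rewrite /d1; ring.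
  by rewrite G13 G23; ring.
have A35 : A i3 i5 = 0.
  apply: (mulfI d1_neq0); rewrite mulr0.
  transitivity (A i2 i2 * (A i1 i1 * A i3 i5 + A i1 i2 * A i3 i4)
     - A i1 i2 * (A i2 i1 * A i3 i5 + A i2 i2 * A i3 i4)); first by rewrite /d1; ring.
  by rewrite G13 G23; ring.
have A33 : A i3 i3 = 1.
  have [detA _ _] := Aq; rewrite -detA det_block212 //.
    by transitivity (d1 * d2 * A i3 i3); [rewrite d12 mul1r|rewrite /d1 /d2; ring].
  by apply: I5P => //; apply: I5P.
have TA i j l : normal_form (normal_mul q 'e_i 'e_j) 'e_l =
    normal_form (normal_mul p (row i A) (row j A)) (row l A).
  rewrite !rowE (presents_mul (normal_metrised p) Aq).
  by rewrite (presents_form (normal_metrised p) Aq).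
have := (TA i3 i4 i4, TA i3 i4 i5, TA i3 i5 i5, TA i4 i4 i4, TA i4 i4 i5,
         TA i4 i5 i5, TA i5 i5 i5).
rewrite !normal_trilinearE !mxE /=.
rewrite p0 q0 ?(A33, A34, A35).
rewrite !(mulr0, mul0r, mulr1, mul1r, add0r, addr0).
case=> [[[[[[q344 q345] q355] q444] q445] q455] q555].
exists (A i4 i4), (A i5 i4), (A i4 i5), (A i5 i5), (A i4 i3), (A i5 i3).
have bE : cb q = cb p * A i4 i4 ^+ 2 + 2 * cc p * A i4 i4 * A i4 i5 + cd p * A i4 i5 ^+ 2.
  by rewrite q344; ring.
have cE : cc q = cb p * A i4 i4 * A i5 i4
      + cc p * (A i4 i4 * A i5 i5 + A i5 i4 * A i4 i5) + cd p * A i4 i5 * A i5 i5.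
  by rewrite q345; ring.
have dE : cd q = cb p * A i5 i4 ^+ 2 + 2 * cc p * A i5 i4 * A i5 i5 + cd p * A i5 i5 ^+ 2.
  by rewrite q355; ring.
split; first by have -> : A i4 i4 * A i5 i5 - A i5 i4 * A i4 i5 = d2 by rewrite /d2; ring.
- by split.
- by rewrite q444 bE; ring.
- by rewrite q445 bE cE; ring.
- by split; [rewrite q455 cE dE; ring|rewrite q555 dE; ring].
Qed.

Lemma small_annihilator_rank1 (s : R) :
  is_sign s -> small_annihilator (Coefs 0 s 0 0 0 0 1 0).
Proof.
move=> /sign_neq0 s0 x x0.
have := (x0 'e_i3, x0 'e_i4, x0 'e_i5); rewrite !normal_mulE /=.
case=> [[/rowP x3 /rowP x4] /rowP x5].
have := x3 i2; rewrite !mxE /= !(mulr0, mul0r, mulr1, mul1r, add0r, addr0).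
move=> /eqP; rewrite mulf_eq0 (negbTE s0) /= => /eqP x40.
have := x4 i2; rewrite !mxE /= x40 !(mulr0, mul0r, mulr1, mul1r, add0r, addr0).
move=> /eqP; rewrite mulf_eq0 (negbTE s0) /= => /eqP x30.
have := x4 i1; rewrite !mxE /= x40 !(mulr0, mul0r, mulr1, mul1r, add0r, addr0).
by move=> x50; split.
Qed.

(** The product with e3 puts (x4, x5) in the radical of q, which is zero by the discriminant. The
    products with e4 and e5 then say that x3 q = 0. *)
Lemma small_annihilator_rank2 (b c d e f g h : R) :
  c ^+ 2 - b * d != 0 -> small_annihilator (Coefs 0 b c d e f g h).
Proof.
move=> D0 x x0.
have := (x0 'e_i3, x0 'e_i4, x0 'e_i5); rewrite !normal_mulE /=.
case=> [[/rowP x3 /rowP x4] /rowP x5].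
have := (x3 i1, x3 i2); rewrite !mxE /= !(mulr0, mul0r, mulr1, mul1r, add0r, addr0).
case=> x31 x32.
have x40 : x 0 i4 = 0.
  apply: (mulfI D0); rewrite mulr0.
  transitivity (c * (c * x 0 i4 + d * x 0 i5) - d * (b * x 0 i4 + c * x 0 i5)).
    by ring.
  by rewrite x31 x32; ring.
have x50 : x 0 i5 = 0.
  apply: (mulfI D0); rewrite mulr0.
  transitivity (c * (b * x 0 i4 + c * x 0 i5) - b * (c * x 0 i4 + d * x 0 i5)).
    by ring.
  by rewrite x31 x32; ring.
split=> //.
have := (x4 i1, x4 i2, x5 i1); rewrite !mxE /= x40 x50 !(mulr0, mul0r, mulr1, mul1r, add0r, addr0).
case=> [[cx3 bx3] dx3].
apply: (mulfI D0); rewrite mulr0 mulrBl expr2 -mulrA cx3 mulr0.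
by rewrite -mulrA dx3 !mulr0 subrr.
Qed.

(** The annihilator of the exceptional algebra is the line of e1, whereas [ca s = 0] makes both e1
    and e2 annihilate the other algebra. *)
Lemma normal7_not_presented (s : coefs R) A :
  ca s = 0 -> presents (normal_mul (Coefs 1 0 1 0 1 0 0 0)) normal_form A s -> False.
Proof.
move=> s0 As.
have row0 i : (forall y, normal_mul s 'e_i y = 0) ->
    [/\ A i i2 = 0, A i i3 = 0, A i i4 = 0 & A i i5 = 0].
  move=> /(presents_annihilator As); rewrite -rowE => ann.
  have := (ann 'e_i3, ann 'e_i5); rewrite !normal_mulE /= => [[/rowP ann3 /rowP ann5]].
  have := (ann3 i1, ann3 i2, ann5 i1, ann5 i2).
  rewrite !mxE /= !(mulr0, mul0r, mulr1, mul1r, add0r, addr0).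
  by case=> [[[-> ->] ->] ->].
have [A12 A13 A14 A15] := row0 i1 (annihilator1 s).
have [A22 A23 A24 A25] := row0 i2 (fun y => annihilator2 y s0).
have G := presents_gram As.
have := (G i1 i5, G i2 i5, G i2 i4).
rewrite /= ?(A12, A13, A14, A15, A22, A23, A24, A25) !(mul0r, addr0).
case=> [[G15 G25] G24].
have A55 : A i5 i5 != 0 by apply: contra_eq_neq G15 => ->; rewrite mulr0 eq_sym oner_neq0.
move/eqP: G25; rewrite mulf_eq0 (negbTE A55) orbF => /eqP A21.
by move/eqP: G24; rewrite A21 mul0r eq_sym oner_eq0.
Qed.

(** * Invariants separating the normal forms *)

Definition hyperbolic_pair (e h : R) : Prop :=
  [\/ e = 0 /\ h = 0, e = 1 /\ h = 0 |
      0 < e /\ exists2 s, is_sign s & h = s * e].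

(** The families are regrouped by the type of q: the second and third merge into one with [alpha]
    non-negative, and the fourth to sixth into one hyperbolic family. *)
Variant normal_spec : coefs R -> Prop :=
| NormalRank1 s of is_sign s : normal_spec (Coefs 0 s 0 0 0 0 1 0)
| NormalDefinite s alpha of is_sign s & 0 <= alpha :
    normal_spec (Coefs 0 s 0 s alpha 0 0 0)
| NormalHyperbolic e h of hyperbolic_pair e h :
    normal_spec (Coefs 0 0 1 0 e 0 0 h)
| NormalExceptional : normal_spec (Coefs 1 0 1 0 1 0 0 0).

Lemma normal_coefsP p : normal_coefs p -> normal_spec p.
Proof.
case=> [s sS|s sS|s alpha sS a0|||s alpha sS a0|].
- exact: NormalRank1.
- exact: NormalDefinite.
- by apply: NormalDefinite => //; apply: ltW.
- by apply: NormalHyperbolic; constructor 1.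
- by apply: NormalHyperbolic; constructor 2.
- by apply: NormalHyperbolic; constructor 3; split=> //; exists s.
- exact: NormalExceptional.
Qed.

Lemma sign_mul_sqr (s t x : R) : is_sign s -> is_sign t -> s = t * x ^+ 2 -> s = t.
Proof.
have x2 := sqr_ge0 x.
by case=> -> [] -> // sE; exfalso; move: sE x2; move: (x ^+ 2) => y sE y0; lra.
Qed.

(** A non-zero product is s e^2, which gives the sign and, since [e] is positive, [e] itself. A zero
    product leaves (0, 0) and (1, 0), told apart by the vanishing of the pair. *)
Lemma hyperbolic_pair_inj (e h e' h' : R) :
  hyperbolic_pair e h -> hyperbolic_pair e' h' -> e * h = e' * h' ->
  (e == 0) && (h == 0) = (e' == 0) && (h' == 0) -> e = e' /\ h = h'.
Proof.
case=> [[-> ->]|[-> ->]|[e0 [s sS ->]]]; case=> [[-> ->]|[-> ->]|[e'0 [s' s'S ->]]] //.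
- by rewrite eqxx oner_eq0.
- by rewrite mul0r => /eqP; rewrite eq_sym !mulf_eq0 (negbTE (sign_neq0 s'S)) gt_eqF.
- by rewrite eqxx oner_eq0.
- by rewrite mulr0 => /eqP; rewrite eq_sym !mulf_eq0 (negbTE (sign_neq0 s'S)) gt_eqF.
- by rewrite mul0r => /eqP; rewrite !mulf_eq0 (negbTE (sign_neq0 sS)) gt_eqF.
- by rewrite mulr0 => /eqP; rewrite !mulf_eq0 (negbTE (sign_neq0 sS)) gt_eqF.
move=> ee _.
have e2 : 0 < e ^+ 2 by rewrite exprn_gt0.
have e'2 : 0 < e' ^+ 2 by rewrite exprn_gt0.
have se : s * e ^+ 2 = s' * e' ^+ 2 by transitivity (e * (s * e)); [|rewrite ee]; ring.
have ss : s = s' by case: sS s'S se => -> [] -> //; lra.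
have eq2 : e ^+ 2 = e' ^+ 2 by apply: (mulfI (sign_neq0 sS)); rewrite se ss.
suff -> : e = e' by rewrite ss.
by apply/eqP; rewrite -(@eqrXn2 _ 2) ?ltW // eq2.
Qed.

Lemma block_discriminant p q : block_equivalent p q -> exists2 D,
  0 < D & cc q ^+ 2 - cb q * cd q = (cc p ^+ 2 - cb p * cd p) * D.
Proof.
case=> k [l [m [n [_ [_ [D0 [-> -> ->] _ _ _]]]]]].
by exists ((k * n - l * m) ^+ 2); [rewrite exprn_even_gt0|ring].
Qed.

Lemma block_rank1 (s t : R) : is_sign s -> is_sign t ->
  block_equivalent (Coefs 0 s 0 0 0 0 1 0) (Coefs 0 t 0 0 0 0 1 0) -> s = t.
Proof.
move=> sS tS [k [l [m [n [_ [_ [_ /= [bE _ _] _ _ _]]]]]]].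
by apply/esym/(sign_mul_sqr (x := k)) => //; rewrite bE; ring.
Qed.

(** The sign of q is invariant, so the substitution is orthogonal and z = k + i l has modulus 1.
    Eliminating [u] and [v] gives [beta] and 0 as [alpha] times Re z^3 and - Im z^3, whence beta^2 =
    alpha^2. *)
Lemma block_definite (s t alpha beta : R) :
  is_sign s -> is_sign t -> 0 <= alpha -> 0 <= beta ->
  block_equivalent (Coefs 0 s 0 s alpha 0 0 0) (Coefs 0 t 0 t beta 0 0 0) ->
  s = t /\ alpha = beta.
Proof.
move=> sS tS a0 b0 [k [l [m [n [u [v [_ /= [bE cE dE] eE fE [gE hE]]]]]]]].
have st : s = t.
  have := sqr_ge0 k; have := sqr_ge0 m.
  have {bE}: t = s * (k ^+ 2 + m ^+ 2) by rewrite bE; ring.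
  move: (k ^+ 2) (m ^+ 2) => x y.
  by case: sS tS => -> [] -> // xy x0 y0; exfalso; lra.
split=> //; rewrite -{t tS}st in bE cE dE eE fE gE hE.
have s_inj := mulfI (sign_neq0 sS).
have km : m ^+ 2 = 1 - k ^+ 2 by apply: s_inj; lra.
have ln : n ^+ 2 = 1 - l ^+ 2 by apply: s_inj; lra.
have klmn : m * n = - (k * l) by apply: s_inj; lra.
have kl : k ^+ 2 + l ^+ 2 = 1.
  have : (m * n) ^+ 2 = (k * l) ^+ 2 by rewrite klmn sqrrN.
  rewrite exprMn km ln => /eqP; rewrite -subr_eq0 => /eqP kl.
  by apply/esym/eqP; rewrite -subr_eq0 -kl; apply/eqP; ring.
have e1 : beta = alpha * (k ^+ 3 - 3 * k * l ^+ 2) by lra.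
have h1 : 0 = alpha * (l ^+ 3 - 3 * k ^+ 2 * l) by lra.
have : beta ^+ 2 + 0 ^+ 2 = alpha ^+ 2 * (k ^+ 2 + l ^+ 2) ^+ 3.
  by rewrite [in X in _ + X]h1 e1; ring.
rewrite kl expr1n mulr1 expr0n addr0 => /eqP.
by rewrite eqrXn2 // => /eqP.
Qed.

(** A substitution preserving x4 x5 scales the variables by inverse factors, possibly exchanging
    them. It keeps the product of the two cubes' coefficients and whether both vanish, as
    [hyperbolic_pair_inj] requires. *)
Lemma block_hyperbolic (e h e' h' : R) :
  hyperbolic_pair e h -> hyperbolic_pair e' h' ->
  block_equivalent (Coefs 0 0 1 0 e 0 0 h) (Coefs 0 0 1 0 e' 0 0 h') ->
  e = e' /\ h = h'.
Proof.
move=> eh eh' [k [l [m [n [u [v [_ /= [bE cE dE] eE _ [_ hE]]]]]]]].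
have {bE} km : k * m = 0 by lra.
have {dE} ln : l * n = 0 by lra.
have {cE} knlm : k * n + l * m = 1 by rewrite [RHS]cE; ring.
have {}eE : e' = e * k ^+ 3 + h * m ^+ 3 by rewrite eE; ring.
have {}hE : h' = e * l ^+ 3 + h * n ^+ 3 by rewrite hE; ring.
have cube_neq0 (x : R) : x != 0 -> (x ^+ 3 == 0) = false.
  by move=> x0; rewrite expf_eq0 (negbTE x0).
have z3 : 0 ^+ 3 = 0 :> R by rewrite expr0n.
apply: hyperbolic_pair_inj => //; have [k0|k0] := eqVneq k 0.
- rewrite k0 mul0r add0r in knlm.
  have l0 : l != 0 by apply: contra_eq_neq knlm => ->; rewrite mul0r eq_sym oner_neq0.
  have m0 : m != 0 by apply: contra_eq_neq knlm => ->; rewrite mulr0 eq_sym oner_neq0.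
  have n0 : n = 0 by apply: (mulfI l0); rewrite ln mulr0.
  rewrite eE hE k0 n0.
  by transitivity (e * h * (l * m) ^+ 3); [rewrite knlm|]; ring.
- have m0 : m = 0 by apply: (mulfI k0); rewrite km mulr0.
  rewrite m0 mulr0 addr0 in knlm.
  have n0 : n != 0 by apply: contra_eq_neq knlm => ->; rewrite mulr0 eq_sym oner_neq0.
  have l0 : l = 0 by apply: (mulIf n0); rewrite ln mul0r.
  rewrite eE hE m0 l0.
  by transitivity (e * h * (k * n) ^+ 3); [rewrite knlm|]; ring.
- rewrite k0 mul0r add0r in knlm.
  have l0 : l != 0 by apply: contra_eq_neq knlm => ->; rewrite mul0r eq_sym oner_neq0.
  have m0 : m != 0 by apply: contra_eq_neq knlm => ->; rewrite mulr0 eq_sym oner_neq0.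
  have n0 : n = 0 by apply: (mulfI l0); rewrite ln mulr0.
  rewrite eE hE k0 n0 z3 !mulr0 add0r addr0.
  by rewrite (mulf_eq0 e) (mulf_eq0 h) !cube_neq0 // !orbF andbC.
- have m0 : m = 0 by apply: (mulfI k0); rewrite km mulr0.
  rewrite m0 mulr0 addr0 in knlm.
  have n0 : n != 0 by apply: contra_eq_neq knlm => ->; rewrite mulr0 eq_sym oner_neq0.
  have l0 : l = 0 by apply: (mulIf n0); rewrite ln mul0r.
  rewrite eE hE m0 l0 z3 !mulr0 add0r addr0.
  by rewrite (mulf_eq0 e) (mulf_eq0 h) !cube_neq0 // !orbF.
Qed.

Lemma normal_unique p q A : normal_coefs p -> normal_coefs q ->
  presents (normal_mul p) normal_form A q -> p = q.
Proof.
move=> p_normal q_normal Aq.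
(* The inverse base change serves when [q] alone is the exceptional algebra. *)
have [B Bp] : exists B, presents (normal_mul q) normal_form B p.
  exists (1%:M *m invmx A); apply: presents_quotient Aq _; first exact: normal_metrised.
  by split; [exact: det1|move=> x; rewrite mulmx1|move=> x; rewrite mulmx1].
have small : ca p = 0 -> small_annihilator p.
  case: p_normal {Aq Bp} => [s sS|s sS|s a sS _|||s a sS _|] /= p0;
    last by move/eqP: p0; rewrite oner_eq0.
    exact: small_annihilator_rank1.
  1-5: apply: small_annihilator_rank2; rewrite ?expr0n ?expr1n ?mul0r ?subr0 ?oner_neq0 //.
  1-2: by rewrite sub0r oppr_eq0 -expr2 sqrf_eq0 sign_neq0.
have block (p0 : ca p = 0) (q0 : ca q = 0) := presents_blocks Aq (small p0) p0 q0.
have disc (p0 : ca p = 0) (q0 : ca q = 0) := block_discriminant (block p0 q0).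
case/normal_coefsP: p_normal Aq Bp block disc {small}
    => [s sS|s alpha sS a0|e h eh|];
  case/normal_coefsP: q_normal => [t tS|t beta tS b0|e' h' eh'|] //= Aq Bp.
all: try by case: (normal7_not_presented _ Aq).
all: try by case: (normal7_not_presented _ Bp).
(* Both forms now have [ca] zero. The discriminant is 0, -1 or 1 for rank one, definite or
   hyperbolic q, and a positive factor cannot turn one of these into another. *)
all: move=> /(_ erefl erefl) block /(_ erefl erefl) [D D0].
all: rewrite ?expr0n ?expr1n /= ?mulr0n ?mul0r ?mulr0 ?subr0 ?sub0r -?expr2.
all: rewrite ?(sign_sqr sS) ?(sign_sqr tS) => discE.
all: try by exfalso; lra.
- by rewrite (block_rank1 sS tS block).
- by have [-> ->] := block_definite sS tS a0 b0 block.
- by have [-> ->] := block_hyperbolic eh eh' block.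
Qed.

End Uniqueness.

(** * Null frames *)

Section Structure.

Context {R : realType} {mul : 'rV[R]_5 -> 'rV[R]_5 -> 'rV[R]_5}
  {g : 'rV[R]_5 -> 'rV[R]_5 -> R} (mul_metrised : commutative_metrised mul g).

Let mulC := cm_mulC mul_metrised.
Let gC := cm_formC mul_metrised.
Let gA := cm_formA mul_metrised.
Let gDl := cm_formDl mul_metrised.
Let gDr := cm_formDr mul_metrised.
Let gZl := cm_formZl mul_metrised.
Let gZr := cm_formZr mul_metrised.
Let mulDl := cm_mulDl mul_metrised.
Let mulDr := cm_mulDr mul_metrised.
Let mulZl := cm_mulZl mul_metrised.
Let mulZr := cm_mulZr mul_metrised.
Let mul0 := cm_mulr0 mul_metrised.
Let gr0 := cm_formr0 mul_metrised.

(** * Orthogonal vectors and decompositions *)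

Lemma form_row_sum (x y : 'rV[R]_5) : g x y = \sum_i x 0 i * g (delta_mx 0 i) y.
Proof. by rewrite {1}[x]row_sum_delta !big_I5 !gDl !gZl. Qed.

Lemma orthogonal_vector (s : seq 'rV[R]_5) : (size s < 5)%N ->
  exists2 x : 'rV[R]_5, x != 0 & forall v, v \in s -> g x v = 0.
Proof.
move=> s5; pose C : 'M[R]_(5, size s) := \matrix_(i, j) g (delta_mx 0 i) s`_j.
have kC : kermx C != 0.
  by rewrite -mxrank_eq0 mxrank_ker subn_eq0 -ltnNge (leq_ltn_trans (rank_leq_col _)).
exists (nz_row (kermx C)); first by rewrite nz_row_eq0.
move=> v vs; have /sub_kermxP/rowP := nz_row_sub (kermx C).
have iv : (index v s < size s)%N by rewrite index_mem.
move/(_ (Ordinal iv)); rewrite !mxE => <-; rewrite form_row_sum.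
by apply: eq_bigr => i _; rewrite !mxE /= nth_index.
Qed.

(** The ideals are the image and the kernel of [f]: they are ideals because [f] commutes with
    multiplications, complementary because it is idempotent, and orthogonal because it is
    self-adjoint. *)
Lemma projection_decomposable (f : 'rV[R]_5 -> 'rV[R]_5) :
  linear f -> (forall x, f (f x) = f x) ->
  (exists x, f x != 0) -> (exists x, f x != x) ->
  (forall x y, g (f x) y = g x (f y)) ->
  (forall x y, mul (f x) y = f (mul x y)) -> decomposable mul g.
Proof.
move=> f_lin ff [x fx0] [x' fx'] gf mulf.
pose F : {linear 'rV[R]_5 -> 'rV[R]_5} :=
  HB.pack f (GRing.isLinear.Build R _ _ _ f f_lin).
pose L := linfun F.
have LE y : L y = f y by rewrite lfunE.
have f0 : f 0 = 0 by rewrite -(linear0 F).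
exists (limg L), (lker L); split; [split|split|split|].
- move=> u v /memv_imgP[y _ ->]; rewrite (mulC v) LE mulf -LE.
  by rewrite memv_img ?memvf.
- move=> u v; rewrite memv_ker LE => /eqP fu.
  by rewrite (mulC v) memv_ker LE -mulf fu mulC mul0.
- apply/eqP => /vspaceP /(_ (L x)); rewrite memv_img ?memvf // memv0 LE => /esym.
  exact/negP.
- apply/eqP => /vspaceP /(_ (x' - f x')); rewrite memv_ker memv0 LE.
  rewrite -[f (x' - _)]/(F (x' - f x')) linearB /= ff subrr eqxx => /esym.
  by rewrite subr_eq0 eq_sym (negbTE fx').
- apply/vspaceP => y; rewrite memvf; apply/memv_addP.
  exists (L y); first by rewrite memv_img ?memvf.
  exists (y - f y); last by rewrite LE addrC subrK.
  by rewrite memv_ker LE -[f _]/(F _) linearB /= ff subrr.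
- apply/vspaceP => y; rewrite memv_cap memv0 memv_ker; apply/andP/eqP => [[]|->].
    by move=> /memv_imgP[z _ ->] /eqP; rewrite !LE ff.
  by rewrite mem0v linear0.
- move=> u w /memv_imgP[y _ ->]; rewrite memv_ker !LE => /eqP fw.
  by rewrite gf fw (cm_formr0 mul_metrised).
Qed.

(** The projection is the coordinate one, onto e3 in the first case and onto the plane of e1, e5 in
    the second, carried over by [M]. *)
Lemma split_decomposable M p :
  presents mul g M p -> split_coefs p -> decomposable mul g.
Proof.
move=> Mp p_split; have Mu := presents_unit Mp.
suff [D [D2 [i Di] [j Dj] Dg Dm]] : exists D : 'M[R]_5,
  [/\ D *m D = D, exists i, row i D = delta_mx 0 i, exists i, row i D = 0,
   forall x y, normal_form (x *m D) y = normal_form x (y *m D) &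
   forall x y, normal_mul p (x *m D) y = normal_mul p x y *m D].
  have MM (x : 'rV_5) : x *m invmx M *m M = x by rewrite mulmxKV.
  apply: (@projection_decomposable (fun x => x *m invmx M *m D *m M)).
  - by move=> k x y; rewrite !mulmxDl -!scalemxAl.
  - by move=> x; rewrite mulmxK // -!mulmxA (mulmxA D D) D2.
  - exists (delta_mx 0 i *m M); rewrite mulmxK // -rowE Di -rowE.
    apply/eqP => Mi; move: (congr1 (mulmx^~ (invmx M)) Mi).
    rewrite rowE mulmxK // mul0mx => /rowP/(_ i) /eqP.
    by rewrite !mxE !eqxx oner_eq0.
  - exists (delta_mx 0 j *m M); rewrite mulmxK // -rowE Dj mul0mx.
    apply/eqP => Mi; move: (congr1 (mulmx^~ (invmx M)) Mi).
    rewrite mulmxK // mul0mx => /rowP/(_ j) /eqP.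
    by rewrite !mxE !eqxx eq_sym oner_eq0.
  - move=> x y; rewrite -{1}(MM y) -{2}(MM x) !(presents_form mul_metrised Mp).
    exact: Dg.
  - move=> x y; rewrite -{1}(MM y) -[in RHS](MM x) -[in RHS](MM y).
    by rewrite !(presents_mul mul_metrised Mp) mulmxK // Dm.
case: p_split => [[b0 c0 d0]|[a0 c0 d0 f0 g0]].
  pose D : 'M[R]_5 := mx5 0 0 (delta_mx 0 i3) 0 0.
  have DE x : x *m D = row5 0 0 (x 0 i3) 0 0.
    by apply/rowP; apply: I5P; rewrite !mxE big_I5 !mxE /=; ring.
  exists D; split.
  - by apply/row_matrixP => i; rewrite !rowE mulmxA !DE !mxE.
  - by exists i3; apply/rowP => j; rewrite !mxE.
  - by exists i1; apply/rowP => j; rewrite !mxE.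
  - by move=> x y; rewrite !normal_formE !DE !mxE /=; ring.
  - move=> x y; rewrite DE !normal_mulE DE b0 c0 d0; apply/rowP.
    by apply: I5P; rewrite !mxE /=; ring.
pose D : 'M[R]_5 := mx5 (delta_mx 0 i1) 0 0 0 (delta_mx 0 i5).
have DE x : x *m D = row5 (x 0 i1) 0 0 0 (x 0 i5).
  by apply/rowP; apply: I5P; rewrite !mxE big_I5 !mxE /=; ring.
exists D; split.
- by apply/row_matrixP => i; rewrite !rowE mulmxA !DE !mxE.
- by exists i1; apply/rowP => j; rewrite !mxE.
- by exists i2; apply/rowP => j; rewrite !mxE.
- by move=> x y; rewrite !normal_formE !DE !mxE /=; ring.
- move=> x y; rewrite DE !normal_mulE DE a0 c0 d0 f0 g0; apply/rowP.
  by apply: I5P; rewrite !mxE /=; ring.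
Qed.

(** Otherwise the orthogonal projection onto the line of [u] would split the algebra. *)
Lemma annihilator_isotropic u :
  ~ decomposable mul g -> (forall y, mul y u = 0) -> g u u = 0.
Proof.
move=> indec ann; apply/eqP/negPn/negP => u0; apply: indec.
have u_neq0 : u != 0 by apply: contraNneq u0 => ->; rewrite (cm_formr0 mul_metrised).
have fu : (g u u / g u u) *: u = u by rewrite mulfV ?scale1r.
apply: (@projection_decomposable (fun x => (g x u / g u u) *: u)).
- by move=> k x y; rewrite gDl gZl mulrDl scalerDl -mulrA scalerA.
- by move=> x; rewrite gZl mulfVK.
- by exists u; rewrite fu.
- have [x x0 /(_ u (mem_head _ _)) xu] := @orthogonal_vector [:: u] isT.
  by exists x; rewrite xu mul0r scale0r eq_sym.
- by move=> x y; rewrite gZl gZr (gC u y); field.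
- move=> x y; rewrite gA ann (cm_formr0 mul_metrised) mul0r scale0r.
  by rewrite mulZl mulC ann scaler0.
Qed.

Lemma jordan_coefs M p : presents mul g M p ->
  (forall x y, mul x (mul (mul x x) y) = mul (mul x x) (mul x y)) ->
  ca p = 0 \/ cb p = 0 /\ ca p * ce p = cc p ^+ 2.
Proof.
move=> Mp jordan; have [|a0] := eqVneq (ca p) 0; first by left.
right.
have J x y : normal_mul p x (normal_mul p (normal_mul p x x) y) =
             normal_mul p (normal_mul p x x) (normal_mul p x y).
  apply: (can_inj (mulmxK (presents_unit Mp))).
  by rewrite -!(presents_mul mul_metrised Mp) jordan.
(* In the coefficient of e1, the identity at x = e5, y = e3 says a^2 b = 0; at y = e4 it then says
   a^2 e = a c^2. *)
pose e3 : 'rV[R]_5 := row5 0 0 1 0 0; pose e4 : 'rV[R]_5 := row5 0 0 0 1 0.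
pose e5 : 'rV[R]_5 := row5 0 0 0 0 1.
have J53 := J e5 e3; have J54 := J e5 e4; rewrite !normal_mul_row5 in J53 J54.
have /rowP/(_ i1) := J53; rewrite !mxE /=.
rewrite !(mulr0, mul0r, mulr1, mul1r, add0r, addr0) => E53.
have b0 : cb p = 0.
  by move/eqP: E53; rewrite !mulf_eq0 (negbTE a0) orbF => /eqP.
split=> //.
have /rowP/(_ i1) := J54; rewrite !mxE /= b0.
rewrite !(mulr0, mul0r, mulr1, mul1r, add0r, addr0) => E54.
by apply: (mulfI a0); rewrite [ca p * ce p]mulrC E54; ring.
Qed.

(** * Sylvester's law of inertia *)

Lemma form_sum_orthogonal m (u : 'I_m -> 'rV[R]_5) (a : 'rV[R]_m) :
  (forall i j, i != j -> g (u i) (u j) = 0) ->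
  let x := a *m \matrix_i u i in
  g x x = \sum_i a 0 i ^+ 2 * g (u i) (u i).
Proof.
move=> orth; have gsumr y (I : finType) (F : I -> 'rV[R]_5) : g y (\sum_i F i) = \sum_i g y (F i).
  by apply: (big_morph (g y)) => [? ?|]; rewrite ?gDr ?gr0.
rewrite /= mulmx_sum_row gsumr; apply: eq_bigr => i _.
rewrite rowK gZr gC gsumr (bigD1 i) //= big1 ?addr0.
  by rewrite rowK gZr mulrA.
by move=> j ji; rewrite rowK gZr orth ?mulr0 // eq_sym.
Qed.

(** More than five vectors satisfy a linear relation, which equates a combination of the [u] with
    one of the [w]. Its square is both non-negative and non-positive, so all coefficients vanish. *)
Lemma inertia m n (u : 'I_m -> 'rV[R]_5) (w : 'I_n -> 'rV[R]_5) :
  (forall i j, i != j -> g (u i) (u j) = 0) -> (forall i, 0 < g (u i) (u i)) ->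
  (forall i j, i != j -> g (w i) (w j) = 0) -> (forall i, g (w i) (w i) < 0) ->
  (m + n <= 5)%N.
Proof.
move=> u_orth u_gt0 w_orth w_lt0; rewrite leqNgt; apply/negP => mn.
pose C : 'M[R]_(m + n, 5) := col_mx (\matrix_i u i) (\matrix_i w i).
have kC : kermx C != 0.
  by rewrite -mxrank_eq0 mxrank_ker subn_eq0 -ltnNge (leq_ltn_trans (rank_leq_col _)).
have /sub_kermxP := nz_row_sub (kermx C).
have : nz_row (kermx C) != 0 by rewrite nz_row_eq0.
move: (nz_row _) => c c0; rewrite -[c]hsubmxK mul_row_col.
set a := lsubmx c; set b := rsubmx c => /eqP; rewrite addr_eq0 => /eqP ab.
have := form_sum_orthogonal a u_orth; rewrite /= ab -scaleN1r gZl gZr !mulN1r opprK.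
rewrite (form_sum_orthogonal b w_orth) => ab2.
have a_ge0 i : 0 <= a 0 i ^+ 2 * g (u i) (u i) by rewrite mulr_ge0 ?sqr_ge0 ?ltW.
have b_ge0 i : 0 <= - (b 0 i ^+ 2 * g (w i) (w i)).
  by rewrite -mulrN mulr_ge0 ?sqr_ge0 // oppr_ge0 ltW.
have sa_ge0 : 0 <= \sum_i a 0 i ^+ 2 * g (u i) (u i) by apply: sumr_ge0.
have sb_ge0 : 0 <= \sum_i - (b 0 i ^+ 2 * g (w i) (w i)) by apply: sumr_ge0.
have sb0 : \sum_i - (b 0 i ^+ 2 * g (w i) (w i)) = 0.
  by apply/eqP; rewrite eq_le sb_ge0 andbT sumrN ab2 oppr_le0.
have sa0 : \sum_i a 0 i ^+ 2 * g (u i) (u i) = 0.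
  by rewrite -ab2 -[LHS]opprK -sumrN sb0 oppr0.
have a0 : a = 0.
  apply/rowP => i; rewrite [RHS]mxE; apply/eqP; rewrite -sqrf_eq0.
  have /(_ i isT)/eqP := psumr_eq0P (fun i _ => a_ge0 i) sa0.
  by rewrite mulf_eq0 (gt_eqF (u_gt0 i)) orbF.
have b0 : b = 0.
  apply/rowP => i; rewrite [RHS]mxE; apply/eqP; rewrite -sqrf_eq0.
  have /(_ i isT)/eqP := psumr_eq0P (fun i _ => b_ge0 i) sb0.
  by rewrite oppr_eq0 mulf_eq0 (lt_eqF (w_lt0 i)) orbF.
by move: c0; rewrite -[c]hsubmxK -/a -/b a0 b0 row_mx0 eqxx.
Qed.

Section Signature.

Context (g_signature : has_signature g 3 2).

Lemma no_three_negative x y z :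
  g x y = 0 -> g x z = 0 -> g y z = 0 -> g x x < 0 -> g y y < 0 -> g z z < 0 -> False.
Proof.
move=> xy xz yz x0 y0 z0; have [b [_ gb]] := g_signature.
suff : (3 + 3 <= 5)%N by [].
apply: (@inertia _ _ (fun i : 'I_3 => b`_(lshift 2 i)) (fun i : 'I_3 => [:: x; y; z]`_i)).
- by move=> i j ij; rewrite gb (inj_eq (@lshift_inj _ _)) ij.
- by move=> i; rewrite gb eqxx /= ltn_ord ltr01.
- by move=> [[|[|[|//]]] ?] [[|[|[|//]]] ?] //=; rewrite gC.
- by move=> [[|[|[|//]]] ?].
Qed.

Lemma no_four_positive x y z t :
  g x y = 0 -> g x z = 0 -> g x t = 0 -> g y z = 0 -> g y t = 0 -> g z t = 0 ->
  0 < g x x -> 0 < g y y -> 0 < g z z -> 0 < g t t -> False.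
Proof.
move=> xy xz xt yz yt zt x0 y0 z0 t0; have [b [_ gb]] := g_signature.
suff : (4 + 2 <= 5)%N by [].
apply: (@inertia _ _ (fun i : 'I_4 => [:: x; y; z; t]`_i) (fun i : 'I_2 => b`_(rshift 3 i))).
- by move=> [[|[|[|[|//]]]] ?] [[|[|[|[|//]]]] ?] //=; rewrite gC.
- by move=> [[|[|[|[|//]]]] ?].
- by move=> i j ij; rewrite gb (inj_eq (@rshift_inj _ _)) ij.
- by move=> i; rewrite gb eqxx /= oppr_lt0 ltr01.
Qed.

End Signature.

(** * Nilpotency and socles *)

Lemma nilpotent_trap (S : 'rV[R]_5 -> Prop) x :
  is_nilpotent mul -> S x -> (forall x, S x -> exists y, S (mul y x)) -> S 0.
Proof.
case=> m m0 nil Sx step.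
(* Multiplying again and again within [S] gives products of every length. *)
suff [y Sy /nil <-//] : exists2 y, S y & is_product mul m y.
case: m m0 {nil} => // m _; elim: m => [|m [y Sy ym]].
  by exists x => //; exact: product_one.
have [z Sz] := step y Sy; exists (mul z y) => //.
exact: (product_mul (product_one mul z) ym).
Qed.

(** If each element of [S] outside [P] had a multiple outside [P], the trap would put 0 outside [P].
    Taking for [P] the zero space or the line of e1 gives the first and the second socle. *)
Lemma nilpotent_socle (S P : 'rV[R]_5 -> Prop) x :
  is_nilpotent mul -> S x -> ~ P x -> P 0 -> (forall x y, S x -> S (mul y x)) ->
  exists x, [/\ S x, ~ P x & forall y, P (mul y x)].
Proof.
move=> nil Sx Px P0 Smul; apply: contrapT => none.
suff [] : S 0 /\ ~ P 0 by [].
apply: (nilpotent_trap (S := fun x => S x /\ ~ P x) nil (conj Sx Px)).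
move=> {Px Sx}x [Sx Px]; apply: contrapT => noy; apply: none; exists x; split=> // y.
by apply: contrapT => Py; apply: noy; exists y; split=> //; exact: Smul.
Qed.

Lemma dual_vector e1 : e1 != 0 -> g e1 e1 = 0 -> exists e5, g e1 e5 = 1 /\ g e5 e5 = 0.
Proof.
move=> e1_neq0 e11.
have [y y0] : exists y, g e1 y != 0.
  apply: contrapT => none; move/eqP: e1_neq0; apply.
  apply: (cm_nondegenerate mul_metrised) => y; apply/eqP/negPn/negP => gy.
  by apply: none; exists y.
have [z e1z] : exists z, g e1 z = 1.
  by exists ((g e1 y)^-1 *: y); rewrite gZr mulVf.
exists (z + (- (g z z / 2)) *: e1); rewrite !(gDr, gDl, gZr, gZl) (gC z e1) e11 e1z.
by split; field.
Qed.

Section NullFrame.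

Context (mul_nilpotent : is_nilpotent mul) (e1 e5 : 'rV[R]_5)
  (e1_ann : forall y, mul y e1 = 0) (e11 : g e1 e1 = 0) (e15 : g e1 e5 = 1)
  (e55 : g e5 e5 = 0).

(** Orthogonality to [e5] picks one representative modulo the line of [e1]. *)
Definition second_socle x : Prop :=
  [/\ g e1 x = 0, g e5 x = 0 & forall y, exists k, mul y x = k *: e1].

(** The vectors orthogonal to [e1] and [s] form an ideal, since products with [s] lie on the line of
    [e1]. By dimension this ideal is larger than that line, so [nilpotent_socle] applies modulo it;
    a multiple of [e1] finally restores orthogonality to [e5]. *)
Lemma second_socle_next (s : seq 'rV[R]_5) : (size s < 3)%N ->
  (forall v, v \in s -> second_socle v) ->
  exists x, [/\ x != 0, second_socle x & forall v, v \in s -> g v x = 0].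
Proof.
move=> s3 s_socle.
have [|x0 x0_neq0 x0_orth] := orthogonal_vector (s := [:: e1, e5 & s]).
  by rewrite /= !ltnS.
pose S x := g e1 x = 0 /\ forall v, v \in s -> g v x = 0.
pose P x := exists k, x = k *: e1.
have [| | | |x [[e1x sx] Px ann]] := @nilpotent_socle S P x0 mul_nilpotent.
- split=> [|v vs]; rewrite gC x0_orth ?inE ?eqxx //.
  by rewrite vs !orbT.
- case=> k x0E; have := x0_orth e5; rewrite !inE eqxx orbT => /(_ isT).
  rewrite x0E gZl e15 mulr1 => k0.
  by move: x0_neq0; rewrite x0E k0 scale0r eqxx.
- by exists 0; rewrite scale0r.
- move=> x y [e1x sx]; split=> [|v vs]; first by rewrite -gA mulC e1_ann gC gr0.
  have [_ _ /(_ y)[k vy]] := s_socle v vs.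
  by rewrite -gA mulC vy gZl e1x mulr0.
exists (x + (- g e5 x) *: e1); split.
- apply/eqP => /eqP; rewrite scaleNr subr_eq0 => /eqP xE.
  by apply: Px; exists (g e5 x).
- split=> [||y]; rewrite ?gDr ?gZr ?e11 ?(gC e5 e1) ?e15 ?e1x; try by ring.
  by rewrite mulDr mulZr e1_ann scaler0 addr0; exact: ann.
- move=> v vs; rewrite gDr gZr sx //; have [v1 _ _] := s_socle v vs.
  by rewrite (gC v) v1; ring.
Qed.

Lemma second_socleD x y t :
  second_socle x -> second_socle y -> second_socle (x + t *: y).
Proof.
move=> [x1 x5 xann] [y1 y5 yann]; split; rewrite ?gDr ?gZr ?x1 ?y1 ?x5 ?y5; try ring.
move=> z; have [k xk] := xann z; have [l yl] := yann z.
by exists (k + t * l); rewrite mulDr mulZr xk yl scalerA scalerDl.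
Qed.

Lemma isotropic_combination x y :
  second_socle x -> second_socle y -> g x y = 0 -> 0 < g x x -> g y y < 0 ->
  exists z, [/\ z != 0, second_socle z & g z z = 0].
Proof.
move=> xS yS xy x0 y0; pose t := Num.sqrt (g x x / - g y y).
have t2 : t ^+ 2 = g x x / - g y y by rewrite sqr_sqrtr // ltW // divr_gt0 // oppr_gt0.
exists (x + t *: y); split; last 1 first.
- rewrite !(gDl, gDr, gZl, gZr) (gC y) xy.
  transitivity (g x x + t ^+ 2 * g y y); first by ring.
  by rewrite t2; field; rewrite lt_eqF.
- apply: contraTneq x0 => z0; have : g (x + t *: y) x = 0 by rewrite z0 gC gr0.
  by rewrite gDl gZl (gC y) xy mulr0 addr0 => ->; rewrite ltxx.
- exact: second_socleD.
Qed.

(* Among three mutually orthogonal vectors of the second socle, two have opposite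
   signs or one is isotropic: e1 - e5 leaves no room for two negative ones, and
   e1 + e5 no room for three positive ones. *)
Lemma second_socle_isotropic : has_signature g 3 2 ->
  exists z, [/\ z != 0, second_socle z & g z z = 0].
Proof.
move=> sig; have plus x : second_socle x -> g (e1 + e5) x = 0.
  by case=> x1 x5 _; rewrite gDl x1 x5 addr0.
have minus x : second_socle x -> g (e1 + (-1) *: e5) x = 0.
  by case=> x1 x5 _; rewrite gDl gZl x1 x5 mulr0 addr0.
have plus_gt0 : 0 < g (e1 + e5) (e1 + e5).
  by rewrite !(gDl, gDr) e11 e55 (gC e5) e15; lra.
have minus_lt0 : g (e1 + (-1) *: e5) (e1 + (-1) *: e5) < 0.
  by rewrite !(gDl, gDr, gZl, gZr) e11 e55 (gC e5) e15; lra.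
have [//|//|x [x_neq0 xS _]] := @second_socle_next [::].
have [|v|y [y_neq0 yS /(_ x (mem_head _ _)) xy]] := @second_socle_next [:: x].
- by [].
- by rewrite inE => /eqP ->.
have [x0|x0|x0] := ltgtP (g x x) 0; last by exists x.
  have [y0|y0|y0] := ltgtP (g y y) 0; last by exists y.
    by case: (no_three_negative sig (minus _ xS) (minus _ yS) xy).
  by apply: (isotropic_combination yS xS) => //; rewrite gC.
have [y0|y0|y0] := ltgtP (g y y) 0; last by exists y.
  exact: (isotropic_combination xS yS).
have [|v|z [z_neq0 zS zo]] := @second_socle_next [:: x; y].
- by [].
- by rewrite !inE => /orP[] /eqP ->.
have xz : g x z = 0 by apply: zo; rewrite inE eqxx.
have yz : g y z = 0 by apply: zo; rewrite !inE eqxx orbT.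
have [z0|z0|z0] := ltgtP (g z z) 0; last by exists z.
  exact: (isotropic_combination xS zS).
by case: (no_four_positive sig (plus _ xS) (plus _ yS) (plus _ zS) xy xz yz).
Qed.

End NullFrame.

(** * The cubic form in a null frame *)

Lemma mulmx_mx5 (x e1 e2 e3 e4 e5 : 'rV[R]_5) :
  x *m mx5 e1 e2 e3 e4 e5 = x 0 i1 *: e1 + x 0 i2 *: e2 + x 0 i3 *: e3
                            + x 0 i4 *: e4 + x 0 i5 *: e5.
Proof. by apply/rowP => j; rewrite !mxE big_I5 !mxE. Qed.

Lemma cubicD k u w : let q x := g (mul x x) x in
  q (k *: u + w) = k ^+ 3 * q u + 3 * k ^+ 2 * g (mul u u) w
                   + 3 * k * g (mul u w) w + q w.
Proof.
rewrite /= !(mulDl, mulDr, mulZl, mulZr, gDl, gDr, gZl, gZr).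
have -> : g (mul w u) w = g (mul u w) w by rewrite mulC.
have -> : g (mul w w) u = g (mul u w) w by rewrite gA gC (mulC w u).
have -> : g (mul w u) u = g (mul u u) w by rewrite gA gC.
have -> : g (mul u w) u = g (mul u u) w by rewrite (mulC u w) gA gC.
ring.
Qed.

Section Frame.

Context (e1 e2 e3 e4 e5 : 'rV[R]_5).
Let M := mx5 e1 e2 e3 e4 e5.
Context (M_form : forall x y, g (x *m M) (y *m M) = normal_form x y)
  (M_det : \det M = 1) (mul_nilpotent : is_nilpotent mul)
  (e1_ann : forall y, mul y e1 = 0)
  (e2_ann : forall y, exists k, mul y e2 = k *: e1).

Let M_unit : M \in unitmx. Proof. by rewrite unitmxE M_det unitr1. Qed.

(** Three facts give F its shape: e1 annihilates everything, e2 y is a g(e1, y) e1 by invariance of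
    the metric, and e3 e3 = 0 by nilpotency. *)
Lemma frame_presents : exists p, presents mul g M p.
Proof.
have rowM i : delta_mx 0 i *m M = row i M by rewrite rowE.
have r1 : row i1 M = e1 by apply/rowP => j; rewrite !mxE.
have r2 : row i2 M = e2 by apply/rowP => j; rewrite !mxE.
have r3 : row i3 M = e3 by apply/rowP => j; rewrite !mxE.
have r4 : row i4 M = e4 by apply/rowP => j; rewrite !mxE.
have r5 : row i5 M = e5 by apply/rowP => j; rewrite !mxE.
have G i j : g (row i M) (row j M) = (i + j == 4)%N%:R.
  rewrite -!rowM M_form normal_formE !mxE; move: i j.
  by apply: I5P; apply: I5P; rewrite /= !(mulr0, mul0r, addr0, add0r, mulr1).
have e1M x : g e1 (x *m M) = x 0 i5.
  by rewrite -r1 -rowM M_form normal_formE !mxE /=; ring.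
have e2M x : g e2 (x *m M) = x 0 i4.
  by rewrite -r2 -rowM M_form normal_formE !mxE /=; ring.
have G33 : g e3 e3 = 1 by rewrite -r3 G.
have G13 : g e1 e3 = 0 by rewrite -r1 -r3 G.
have G23 : g e2 e3 = 0 by rewrite -r2 -r3 G.
have G12 : g e1 e2 = 0 by rewrite -r1 -r2 G.
have G15 : g e1 e5 = 1 by rewrite -r1 -r5 G.
have mul1 y : mul e1 y = 0 by rewrite mulC e1_ann.
pose a := g (mul e2 e5) e5.
have mul2 y : mul e2 y = (a * g e1 y) *: e1.
  have [k yk] := e2_ann y; have [l el] := e2_ann e5.
  have kE : k = g (mul y e2) e5 by rewrite yk gZl G15 mulr1.
  have lE : a = l by rewrite /a mulC el gZl G15 mulr1.
  rewrite mulC yk; congr (_ *: _).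
  by rewrite kE gA gC mulC el gZl lE.
(* If c = g (e3 e3) y were non-zero, y e3 would be c e3 modulo e1 and e2, and multiplying by y would
   never lose the e3 component. *)
have T33 y : g (mul e3 e3) y = 0.
  rewrite gA; set c := g e3 (mul e3 y).
  apply/eqP/negPn/negP => c0.
  have mul3 : exists k l, mul y e3 = c *: e3 + k *: e1 + l *: e2.
    pose x := mul y e3 *m invmx M.
    have xM : x *m M = mul y e3 by rewrite mulmxKV.
    exists (x 0 i1), (x 0 i2).
    have x5 : x 0 i5 = 0 by rewrite -e1M xM -gA mul1 gC gr0.
    have x4 : x 0 i4 = 0 by rewrite -e2M xM -gA mul2 gZl G13 mulr0.
    have x3 : x 0 i3 = c.
      have : g e3 (x *m M) = x 0 i3.
        by rewrite -r3 -rowM M_form normal_formE !mxE /=; ring.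
      by rewrite xM mulC => <-.
    rewrite -xM {1}/M mulmx_mx5 x5 x4 x3 !scale0r !addr0.
    by rewrite [LHS]addrC addrA.
  have [k [l mul3E]] := mul3.
  pose S x := exists t k l, t != 0 /\ x = t *: e3 + k *: e1 + l *: e2.
  have [|x|t [k' [l' [t0 /(congr1 (g e3))]]]] := @nilpotent_trap S e3 mul_nilpotent.
  - by exists 1, 0, 0; rewrite oner_neq0 scale1r !scale0r !addr0.
  - case=> t [k' [l' [t0 ->]]]; exists y, (t * c), (t * k + l' * (a * g e1 y)), (t * l).
    split; first by rewrite mulf_neq0.
    rewrite !mulDr !mulZr mul3E e1_ann (mulC y e2) mul2 scaler0 addr0.
    apply/rowP => j; rewrite !mxE; ring.
  - rewrite gr0 !gDr !gZr G33 (gC e3 e1) (gC e3 e2) G13 G23 mulr1 !mulr0 !addr0.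
    by move=> t_eq0; rewrite -t_eq0 eqxx in t0.
exists (Coefs a (g (mul e3 e4) e4) (g (mul e3 e4) e5) (g (mul e3 e5) e5)
  (g (mul e4 e4) e4) (g (mul e4 e4) e5) (g (mul e4 e5) e5) (g (mul e5 e5) e5)).
split; [exact: M_det|by move=> x; rewrite M_form|move=> x].
rewrite normal_cubicE /=.
have -> : x *m M = x 0 i1 *: e1 + (x 0 i2 *: e2
    + (x 0 i3 *: e3 + (x 0 i4 *: e4 + x 0 i5 *: e5))).
  by rewrite /M mulmx_mx5 !addrA.
have expand v : g e1 v = x 0 i5 ->
    g (mul (x 0 i1 *: e1 + (x 0 i2 *: e2 + (x 0 i3 *: e3 + v)))
   (x 0 i1 *: e1 + (x 0 i2 *: e2 + (x 0 i3 *: e3 + v))))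
   (x 0 i1 *: e1 + (x 0 i2 *: e2 + (x 0 i3 *: e3 + v)))
   = 3 * x 0 i2 * (a * x 0 i5 ^+ 2) + 3 * x 0 i3 * g (mul e3 v) v + g (mul v v) v.
  move=> e1v.
  rewrite [LHS]cubicD !mul1 [g (mul (x 0 i2 *: e2 + _) _) _]cubicD.
  rewrite [g (mul (x 0 i3 *: e3 + v) _) _]cubicD.
  rewrite !T33 !mul2 !gZl !(gDr, gZr) e1v G12 G13 !(cm_form0r mul_metrised); ring.
rewrite expand; last first.
  have -> : x 0 i4 *: e4 + x 0 i5 *: e5 = row5 0 0 0 (x 0 i4) (x 0 i5) *m M.
    by rewrite /M mulmx_mx5 !mxE /= !scale0r !add0r.
  by rewrite e1M mxE.
rewrite cubicD !(mulDl, mulDr, mulZl, mulZr, gDl, gDr, gZl, gZr).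
have -> : g (mul e3 e5) e4 = g (mul e3 e4) e5.
  by rewrite mulC gA gC (mulC e3).
ring.
Qed.

End Frame.

(** * Determinants and the existence of a presentation *)

Lemma gram_congruence (N M : 'M[R]_5) i j :
  (N *m gram g *m M^T) i j = g (row i N) (row j M).
Proof.
have gram_delta k l : g (delta_mx 0 k) (delta_mx 0 l) = gram g k l by rewrite mxE.
rewrite -mulmxA mxE form_row_sum; apply: eq_bigr => k _.
rewrite !mxE gC form_row_sum; congr (_ * _).
by apply: eq_bigr => l _; rewrite !mxE mulrC gC.
Qed.

(** Determinants in M G M^T = J give (\det M)^4 = 1, and the only real solutions are 1 and -1. *)
Lemma isometry_det (M : 'M[R]_5) :
  \det (gram g) = 1 \/ \det (gram g) = -1 ->
  (forall x y, g (x *m M) (y *m M) = normal_form x y) -> \det M = 1 \/ \det M = -1.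
Proof.
move=> g_det M_form; pose J : 'M[R]_5 := gram normal_form.
have JE i j : J i j = (i + j == 4)%N%:R.
  rewrite mxE normal_formE !mxE; move: i j.
  by apply: I5P; apply: I5P; rewrite /= !(mulr0, mul0r, addr0, add0r, mulr1).
have MJ : M *m gram g *m M^T = J.
  by apply/matrixP => i j; rewrite gram_congruence !rowE M_form mxE.
have J2 : \det J ^+ 2 = 1.
  rewrite expr2 -det_mulmx -[RHS](det1 R 5); congr (\det _).
  apply/matrixP; apply: I5P; apply: I5P; rewrite mxE big_I5 !JE mxE /=;
    by rewrite !(mulr0, mul0r, mulr1, addr0, add0r).
have := congr1 (fun A : 'M_5 => \det A) MJ; rewrite !det_mulmx det_tr => detE.
have {J2} : (\det M ^+ 2 - 1) * (\det M ^+ 2 + 1) = 0.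
  move: J2; rewrite -detE => /eqP; rewrite -subr_eq0 => /eqP <-.
  by case: g_det => ->; ring.
move/eqP; rewrite mulf_eq0 (gt_eqF (_ : 0 < \det M ^+ 2 + 1)); last first.
  by rewrite ltr_wpDl // sqr_ge0.
by rewrite orbF subr_eq0 sqrf_eq1 => /orP[] /eqP; auto.
Qed.

Lemma exists_null_frame :
  is_nilpotent mul -> ~ decomposable mul g -> has_signature g 3 2 ->
  exists e1 e2 e4 e5 : 'rV[R]_5, [/\
    [/\ g e1 e1 = 0, g e1 e2 = 0, g e1 e4 = 0 & g e1 e5 = 1],
    [/\ g e2 e2 = 0, g e2 e4 = 1 & g e2 e5 = 0],
    [/\ g e4 e4 = 0, g e4 e5 = 0 & g e5 e5 = 0],
    forall y, mul y e1 = 0 &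
    forall y, exists k, mul y e2 = k *: e1].
Proof.
move=> nil indec sig.
have d_neq0 : (delta_mx 0 i1 : 'rV[R]_5) <> 0.
  by move=> /rowP/(_ i1)/eqP; rewrite !mxE oner_eq0.
have [e1 [_ /eqP e1_neq0 e1_ann]] := nilpotent_socle (S := fun=> True)
  (P := fun x => x = 0) nil I d_neq0 erefl (fun _ _ _ => I).
have e11 := annihilator_isotropic indec e1_ann.
have [e5 [e15 e55]] := dual_vector e1_neq0 e11.
have [e2 [e2_neq0 [e12 e52 e2_ann] e22]] :=
  second_socle_isotropic nil e1_ann e11 e15 e55 sig.
have [y [e2y yy]] := dual_vector e2_neq0 e22.
(* The multiples of e1 and e5 make y orthogonal to e5 and e1; the multiple of e2 makes its square
   zero again. *)
exists e1, e2, (y + (- g y e5) *: e1 + (- g y e1) *: e5 + (g y e5 * g y e1) *: e2), e5.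
split=> //; split=> //; rewrite ?(gDl, gDr, gZl, gZr) ?(gC e2 e1) ?(gC e2 e5) ?(gC e5 e1)
  ?(gC e5 y) ?(gC e1 y) ?(gC e2 y) ?(gC y e2) ?e11 ?e12 ?e15 ?e22 ?e2y ?e52 ?e55 ?yy ?(gC e2 e5) ?e52; try ring.
Qed.

Lemma exists_presentation :
  is_nilpotent mul -> ~ decomposable mul g -> has_signature g 3 2 ->
  \det (gram g) = 1 \/ \det (gram g) = -1 -> exists M p, presents mul g M p.
Proof.
move=> nil indec sig g_det.
have [e1 [e2 [e4 [e5 [[e11 e12 e14 e15] [e22 e24 e25] [e44 e45 e55] e1_ann e2_ann]]]]] :=
  exists_null_frame nil indec sig.
have [|x x_neq0 x_orth] := orthogonal_vector (s := [:: e1; e2; e4; e5]).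
  by [].
have x1 : g e1 x = 0 by rewrite gC x_orth // !inE eqxx.
have x2 : g e2 x = 0 by rewrite gC x_orth // !inE eqxx orbT.
have x4 : g e4 x = 0 by rewrite gC x_orth // !inE eqxx !orbT.
have x5 : g e5 x = 0 by rewrite gC x_orth // !inE eqxx !orbT.
have frame_form y1 y2 y3 y4 y5 z1 z2 z3 z4 z5 u v :
    let f t a b c d e := a *: e1 + b *: e2 + c *: t + d *: e4 + e *: e5 in
    g e1 u = 0 -> g e2 u = 0 -> g e4 u = 0 -> g e5 u = 0 ->
    g e1 v = 0 -> g e2 v = 0 -> g e4 v = 0 -> g e5 v = 0 ->
    g (f u y1 y2 y3 y4 y5) (f v z1 z2 z3 z4 z5)
    = y1 * z5 + y2 * z4 + y3 * z3 * g u v + y4 * z2 + y5 * z1.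
  move=> /= u1 u2 u4 u5 v1 v2 v4 v5.
  rewrite !(gDl, gDr, gZl, gZr) !(gC u e1, gC u e2, gC u e4, gC u e5).
  rewrite (gC e2 e1) (gC e4 e1) (gC e5 e1) (gC e4 e2) (gC e5 e2) (gC e5 e4).
  rewrite e11 e12 e14 e15 e22 e24 e25 e44 e45 e55 u1 u2 u4 u5 v1 v2 v4 v5; ring.
have x_ge0 : 0 <= g x x.
  rewrite leNgt; apply/negP => x_lt0.
  (* The vectors e1 - e5 and e2 - e4 already have negative squares. *)
  apply: (no_three_negative sig (x := e1 + (-1) *: e5)
    (y := e2 + (-1) *: e4) (z := x)) => //;
  rewrite !(gDl, gDr, gZl, gZr) ?x1 ?x2 ?x4 ?x5 ?(gC e5 e1) ?(gC e4 e2) ?(gC e5 e2)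
    ?(gC e5 e4) ?e11 ?e12 ?e14 ?e15 ?e22 ?e24 ?e25 ?e44 ?e45 ?e55; lra.
have x_gt0 : 0 < g x x.
  rewrite lt_neqAle x_ge0 andbT eq_sym; apply/eqP => xx.
  (* An isotropic x would be orthogonal to all five vectors of this basis, against
     non-degeneracy. *)
  pose M := mx5 e1 e2 x e4 e5.
  have Mu : M \in unitmx.
    rewrite -row_free_unit; apply: inj_row_free => v vM.
    have pair y1 y2 y4 y5 := frame_form (v 0 i1) (v 0 i2) (v 0 i3) (v 0 i4) (v 0 i5)
      y1 y2 0 y4 y5 x x x1 x2 x4 x5 x1 x2 x4 x5.
    rewrite /= -mulmx_mx5 -/M vM in pair.
    have zero y1 y2 y4 y5 : v 0 i1 * y5 + v 0 i2 * y4 + v 0 i4 * y2 + v 0 i5 * y1 = 0.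
      transitivity (g 0 (y1 *: e1 + y2 *: e2 + 0 *: x + y4 *: e4 + y5 *: e5)).
        by rewrite pair; ring.
      exact: (cm_form0r mul_metrised).
    have v1 : v 0 i1 = 0 by rewrite -(zero 0 0 0 1); ring.
    have v2 : v 0 i2 = 0 by rewrite -(zero 0 0 1 0); ring.
    have v4 : v 0 i4 = 0 by rewrite -(zero 0 1 0 0); ring.
    have v5 : v 0 i5 = 0 by rewrite -(zero 1 0 0 0); ring.
    move/eqP: vM; rewrite /M mulmx_mx5 v1 v2 v4 v5 !scale0r !addr0 !add0r.
    rewrite scaler_eq0 (negbTE x_neq0) orbF => /eqP v3.
    by rewrite (row5K v) v1 v2 v3 v4 v5; apply/rowP; apply: I5P; rewrite !mxE.
  move/eqP: x_neq0; apply; apply: (cm_nondegenerate mul_metrised) => y.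
  rewrite -(mulmxKV Mu y) gC; set c := y *m _.
  by rewrite /M mulmx_mx5 !(gDl, gZl) x1 x2 x4 x5 xx; ring.
have [e3 [e31 e32 e34 e35 e33]] : exists e3, [/\ g e1 e3 = 0, g e2 e3 = 0, g e4 e3 = 0,
    g e5 e3 = 0 & g e3 e3 = 1].
  exists ((Num.sqrt (g x x))^-1 *: x); rewrite !gZr !gZl x1 x2 x4 x5 !mulr0; split=> //.
  by rewrite mulrA -expr2 exprVn sqr_sqrtr // mulVf // gt_eqF.
have M_form s : s ^+ 2 = 1 -> let M := mx5 e1 e2 (s *: e3) e4 e5 in
    forall y z, g (y *m M) (z *m M) = normal_form y z.
  move=> s2 M y z; rewrite !mulmx_mx5 frame_form;
    rewrite ?gZr ?e31 ?e32 ?e34 ?e35 ?mulr0 //.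
  by rewrite gZl e33 mulr1 -expr2 s2 normal_formE; ring.
(* Changing the sign of e3 keeps the metric and turns determinant -1 into 1. *)
have [s s2 detM] : exists2 s : R, s ^+ 2 = 1 & \det (mx5 e1 e2 (s *: e3) e4 e5) = 1.
  have [det1|det1] := isometry_det g_det (M_form 1 (expr1n _ _)).
    by exists 1; rewrite ?expr1n.
  exists (-1); first by rewrite sqrrN expr1n.
  pose d i : 'rV[R]_5 := delta_mx 0 i.
  have -> : mx5 e1 e2 (-1 *: e3) e4 e5
      = mx5 (d i1) (d i2) (- d i3) (d i4) (d i5) *m mx5 e1 e2 (1 *: e3) e4 e5.
    apply/row_matrixP; apply: I5P; rewrite !rowE mulmxA mulmx_mx5 mulmx_mx5 !mulmx_mx5 !mxE /=;
    apply/rowP => j; rewrite !mxE /=; ring.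
  rewrite det_mulmx det1 det_block212; try by rewrite !mxE /= ?oppr0.
    by rewrite !mxE /=; ring.
  by apply: I5P => //; apply: I5P => //; rewrite !mxE /= ?oppr0.
have [p Mp] := frame_presents (M_form s s2) detM nil e1_ann e2_ann.
by exists (mx5 e1 e2 (s *: e3) e4 e5), p.
Qed.

End Structure.

(** * The classification *)

Unset Implicit Arguments.

Theorem theorem5p15 (R : realType)
    (mul : 'rV[R]_5 -> 'rV[R]_5 -> 'rV[R]_5) (g : 'rV[R]_5 -> 'rV[R]_5 -> R)
    (mul_jordan : is_jordan mul)
    (mul_nilpotent : is_nilpotent mul)
    (g_metrised : is_metrised mul g)
    (g_indecomposable : indecomposable mul g)
    (g_signature : has_signature g 3 2)
    (g_det : \det (gram g) = 1 \/ \det (gram g) = -1) :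
  exists! p : coefs R,
    normal_coefs p /\
    unimodularly_isomorphic mul g (normal_mul p) normal_form.
Proof.
have [mul_linear _ mulC jordan] := mul_jordan.
have mul_metrised : commutative_metrised mul g by [].
have [M [p Mp]] :=
  exists_presentation mul_metrised mul_nilpotent g_indecomposable g_signature g_det.
have [q [A Aq] q_cases] : reducible p.
  case: (jordan_coefs mul_metrised Mp jordan); case: p {Mp} => a b c d e f g' h /=.
    by move=> ->; apply: reducible_ca0.
  move=> [-> ae]; have [->|a0] := eqVneq a 0; first exact: reducible_ca0.
  exact: reducible_ca_neq0.
have Mq := presents_trans mul_metrised Mp Aq.
have q_normal : normal_coefs q.
  case: q_cases => // q_split.
  by case: g_indecomposable; apply: (split_decomposable mul_metrised Mq q_split).
exists q; split; first by split=> //; apply: (presents_isomorphic mul_metrised Mq).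
move=> r [r_normal /(isomorphic_presents)[N Nr]].
exact: (normal_unique q_normal r_normal (presents_quotient mul_metrised Mq Nr)).
Qed.
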